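(* Let $H$ be a real Hilbert space and let $F:H\to H$, $F(u)=B(u)-f$ with $f\in H$, be a monotone operator, i.e. $(F(u)-F(v),u-v)\ge0$ for all $u,v\in H$. Assume $F$ has a zero, let $y\in\{z\in H:F(z)=0\}$ be the (unique) minimal-norm solution of $F(u)=0$, let $u_0\in H$ be arbitrary, put $r:=\|y\|+\|u_0\|$, $R:=3r$, $B(u_0,R):=\{u\in H:\|u-u_0\|\le R\}$, and assume that $F$ has Fréchet derivatives $F',F''$ on $B(u_0,R)$ with $\sup_{u\in B(u_0,R)}\|F^{(j)}(u)\|\le M_j<\infty$, $j=1,2$. Then there are positive constants $c_0,c_1,b$ such that, with $\epsilon(t):=c_1(c_0+t)^{-b}$, the following holds. (a) The problem $$\dot u=-\big(F'(u)+\epsilon(t)I\big)^{-1}\big[F(u)+\epsilon(t)u\big],\qquad u(0)=u_0,$$ has a global solution $u(t)$, $t\ge 0$; this solution stays in the ball $B(u_0,R)$, the limit $u(\infty):=\lim_{t\to\infty}u(t)$ exists, and $F(u(\infty))=0$. (b) If, for $\delta>0$, $f_\delta\in H$ satisfies $\|f_\delta-f\|\le\delta$ and $u_\delta(t)$ solves $$\dot u_\delta=-\big(F'(u_\delta)+\epsilon(t)I\big)^{-1}\big[B(u_\delta)-f_\delta+\epsilon(t)u_\delta\big],\qquad u_\delta(0)=u_0,$$ then there is a $t_\delta$ such that $\lim_{\delta\to0}\|u_\delta(t_\delta)-y\|=0$.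
   Context: $(\cdot,\cdot)$ and $\|\cdot\|$ are the inner product and norm of $H$; $I$ is the identity operator; $\dot u=du/dt$. Here $B(\cdot)$ applied to an element of $H$ denotes the nonlinear operator in $F(u)=B(u)-f$, whereas $B(u_0,R)$ denotes the closed ball. *)

(* Defs.v *)
From HB Require Import structures.
From mathcomp Require Import all_boot all_order all_algebra.
From mathcomp Require Import sesquilinear.
From mathcomp Require Import all_classical all_reals all_analysis.

Set Implicit Arguments.
Unset Strict Implicit.
Unset Printing Implicit Defensive.

Import Order.TTheory GRing.Theory Num.Theory.
Import numFieldNormedType.Exports.

Local Open Scope classical_set_scope.
Local Open Scope ring_scope.

(* A real Hilbert space is a complete normed space whose norm comes from an
   inner product; definiteness follows from that of the norm. *)
Definition inner_product (R : realType) (H : completeNormedModType R)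
    (ip : {biscalar H}) : Prop :=
  (forall x y : H, ip x y = ip y x) /\ (forall x : H, ip x x = `|x| ^+ 2).

Definition monotone_op (R : realType) (H : completeNormedModType R)
    (ip : {biscalar H}) (F : H -> H) : Prop :=
  forall u v : H, 0 <= ip (F u - F v) (u - v).

(* Not the library's closed_ball, which is the closure of the open ball and
   hence empty, instead of the singleton {u0}, when rho = 0. *)
Definition cball (R : realType) (H : completeNormedModType R)
    (u0 : H) (rho : R) : set H :=
  [set u | `|u - u0| <= rho].

(* Operator norms are taken in \bar R, so that they are genuine suprema for
   unbounded operators too. *)
Definition opnorm (R : realType) (H : completeNormedModType R)
    (A : H -> H) : \bar R :=
  ereal_sup [set `|A h|%:E | h in [set h : H | `|h| <= 1]].

Definition opnorm2 (R : realType) (H : completeNormedModType R)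
    (Q : H -> H -> H) : \bar R :=
  ereal_sup [set opnorm (Q h) | h in [set h : H | `|h| <= 1]].

(* F' exists at every point of S, and F2 u is the Frechet derivative at u of
   F' : S -> L(H, H) for the operator norm, L(H, L(H, H)) being identified with
   the bounded bilinear maps. Since F' need not exist outside S, the increments
   of F' are taken within S. *)
Definition second_derivative_on (R : realType) (H : completeNormedModType R)
    (F : H -> H) (F2 : H -> {bilinear H -> H -> H}) (S : set H) : Prop :=
  forall u : H, S u ->
    [/\ differentiable F u,
        (opnorm2 (F2 u) < +oo)%E &
        forall e : R, 0 < e ->
          \forall v \near within S (nbhs u),
            (opnorm (fun k : H => 'd F v k - 'd F u k - F2 u (v - u) k)%R
               <= (e * `|v - u|)%:E)%E].

(* Derivative at t relative to J: one-sided at an endpoint of an interval J. *)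
Definition has_derivative_within (R : realType) (H : completeNormedModType R)
    (J : set R) (u : R -> H) (t : R) (v : H) : Prop :=
  (s - t)^-1 *: (u s - u t) @[s --> within J t^'] --> v.

Definition eps_fun (R : realType) (c0 c1 b : R) (t : R) : R :=
  c1 * (c0 + t) `^ (- b).

Definition reg_deriv (R : realType) (H : completeNormedModType R)
    (F : H -> H) (e : R) (u : H) : H -> H :=
  fun h : H => 'd F u h + e *: h.

(* u solves on J, with u(0) = u0, the equation
     u' = - (F'(u) + eps(t) I)^-1 [B(u) - g + eps(t) u],   F(u) = B(u) - f;
   note that F' does not depend on f, while g is either f or its noisy version.
   pinv setT A is the inverse of A, as A is required to be bijective. *)
Definition newton_solution (R : realType) (H : completeNormedModType R)
    (B : H -> H) (f g : H) (eps : R -> R) (u0 : H)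
    (J : set R) (u : R -> H) : Prop :=
  let F := fun v : H => B v - f in
  [/\ is_interval J, J `<=` `[0, +oo[, J 0, u 0 = u0 &
      forall t : R, J t ->
        [/\ differentiable F (u t),
            bijective (reg_deriv F (eps t) (u t)) &
            has_derivative_within J u t
              (- pinv setT (reg_deriv F (eps t) (u t))
                   (B (u t) - g + eps t *: u t))]].

Definition maximal_newton_solution (R : realType)
    (H : completeNormedModType R)
    (B : H -> H) (f g : H) (eps : R -> R) (u0 : H)
    (J : set R) (u : R -> H) : Prop :=
  newton_solution B f g eps u0 J u /\
  forall (J' : set R) (v : R -> H),
    newton_solution B f g eps u0 J' v ->
    J `<=` J' -> (forall t, J t -> v t = u t) -> J' = J.

(* Main.v *)
Require Import Defs.
From HB Require Import structures.
From mathcomp Require Import all_boot all_order all_algebra.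
From mathcomp Require Import sesquilinear.
From mathcomp Require Import all_classical all_reals all_analysis.
From mathcomp Require Import ring lra.

Set Implicit Arguments.
Unset Strict Implicit.
Unset Printing Implicit Defensive.

Import Order.TTheory GRing.Theory Num.Theory.
Import numFieldNormedType.Exports.

Local Open Scope classical_set_scope.
Local Open Scope ring_scope.

(** The flow is an ordinary differential equation for u, but it is nearly linear
    for the residual g = F(u) + eps(t) u.  Differentiating g along a solution
    gives g' = -(g - p) + eps'(t) u, where p is the perturbation of the data
    (p = 0, or the noisy datum minus f), and u is a function of g: the resolvent
    (F + eps I)^-1 of a monotone map is single valued and 1/eps-Lipschitz.  So
    the inverse of F' + eps I disappears from the equation, and everything is
    proved for g and then transported to u.

    Resolvent.  F is controlled on the ball K = B(u0, 3r) only, so the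
    resolvent is taken in the sense of a variational inequality on K
    ([regularized_vi]).  It is solved by contraction with the projection onto K,
    it is Lipschitz in (eps, g) by monotonicity, and its solution solves the
    equation F(u) + eps u = g as soon as it is interior to K.

    Existence.  With eps(t) = c1 / (5 + t) the equation for g has a right-hand
    side which is globally Lipschitz in (t, g), so that Euler's scheme converges
    to a global solution ([lipschitz_ode_solution]).  As long as u stays inside
    K, u solves the Newton equation ([newton_of_residual]).

    Convergence.  Let w(t) solve F(w) + eps(t) w = 0.  Monotonicity gives
    |w| <= |y| and |w(t) - w(s)|^2 <= |w(t)|^2 - |w(s)|^2 for s <= t, so w is
    Cauchy, and its limit is the solution of minimal norm y
    ([regularized_vi_cvg]).  Moreover |u - w| <= |g| / eps, and a differential
    inequality shows (|g| / eps)^2 <= C / (5 + t) ([residual_decay]).  Hence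
    u tends to y.  When c1 is large, C may be taken such that C / 5 = (3r/2)^2, so
    that |u - u0| <= |u - w| + |w| + |u0| <= 5r/2 and u never leaves K.  (When
    r = 0, K is a point and the solution is constant.)

    Noisy data.  Residuals with perturbations p1 and p2 satisfy
    |g1 - g2|^2 <= |p1 - p2|^2 t ([residual_difference]).  With p1 = p2 this is
    uniqueness for the Newton equation, whatever region the solutions visit,
    because F is monotone everywhere.  With p2 = 0 it says that the noisy flow
    follows the exact one on any fixed [0, T] when the noise is small; by
    uniqueness a maximal solution must then reach T.  Choosing T with u(T) close
    to y, and t_delta as an almost minimiser of |u_delta(t) - y| over the domain
    of u_delta, gives the limit. *)

(** * Inner products and derivatives relative to a set *)

Section InnerProduct.
Context (R : realType) (H : completeNormedModType R) (ip : {biscalar H}).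
Hypothesis ip_inner : inner_product ip.

Lemma ipC x y : ip x y = ip y x.
Proof. by case: ip_inner. Qed.

Lemma ipxx x : ip x x = `|x| ^+ 2.
Proof. by case: ip_inner. Qed.

Lemma ipZl a x y : ip (a *: x) y = a * ip x y.
Proof. exact: linearZl_LR. Qed.

Lemma ipZr a x y : ip x (a *: y) = a * ip x y.
Proof. exact: linearZr_LR. Qed.

Definition ipE :=
  (linearDl ip, linearBl ip, linearNl ip, linear0l ip, ipZl,
   linearDr ip, linearBr ip, linearNr ip, linear0r ip, ipZr).

Lemma normB2 x y : `|x - y| ^+ 2 = `|x| ^+ 2 - 2 * ip x y + `|y| ^+ 2.
Proof. rewrite -!ipxx !ipE (ipC y x); ring. Qed.

Lemma Cauchy_Schwarz x y : ip x y <= `|x| * `|y|.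
Proof.
have [->|x0] := eqVneq x 0; first by rewrite !ipE normr0 mul0r.
have [->|y0] := eqVneq y 0; first by rewrite !ipE normr0 mulr0.
have px : 0 < `|x| by rewrite normr_gt0.
have py : 0 < `|y| by rewrite normr_gt0.
have := sqr_ge0 (`| `|y| *: x - `|x| *: y |).
rewrite normB2 !ipE !normrZ !normr_id => h.
have {h} : 0 <= (`|x| * `|y|) * (`|x| * `|y| - ip x y) by nra.
by rewrite pmulr_rge0 ?mulr_gt0// subr_ge0.
Qed.

Lemma Cauchy_Schwarz_abs x y : `|ip x y| <= `|x| * `|y|.
Proof.
rewrite ler_norml Cauchy_Schwarz andbT lerNl -(linearNl ip).
by apply: le_trans (Cauchy_Schwarz _ _) _; rewrite normrN.
Qed.

End InnerProduct.

Section TangentWithin.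
Context (R : realType).

Lemma near_dist_le (V : normedModType R) (x : V) (e : R) : 0 < e ->
  \forall z \near nbhs x, `|z - x| <= e.
Proof.
have /cvgrPdist_le h : (fun z : V => z) @ nbhs x --> x by exact: cvg_id.
by move=> /h; apply: filterS => z; rewrite distrC.
Qed.

Implicit Types (V : normedModType R) (J : set R).

(** Little-o form of the derivative relative to J.  It needs no quotient, so
    that it serves real and vector valued curves alike, and the rules below are
    obtained by adding up error bounds. *)
Definition tangent_within V J (u : R -> V) (t : R) (v : V) : Prop :=
  forall e : R, 0 < e ->
    \forall s \near within J (nbhs t),
      `|u s - u t - (s - t) *: v| <= e * `|s - t|.

Lemma has_derivative_withinP (H : completeNormedModType R) J (u : R -> H) t v :
  has_derivative_within J u t v <-> tangent_within J u t v.
Proof.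
split.
- move=> /cvgrPdist_le h e e0; have := h _ e0.
  rewrite !near_withinE.
  apply: filterS => s /= hs Js.
  have [->|st] := eqVneq s t; first by rewrite !subrr scale0r subrr !normr0 mulr0.
  have st0 : s - t != 0 by rewrite subr_eq0.
  have := hs st Js.
  rewrite -(ler_pM2l (_ : 0 < `|s - t|)) ?normr_gt0// -normrZ scalerBr.
  by rewrite scalerA mulfV// scale1r distrC mulrC.
- move=> h; apply/cvgrPdist_le => e e0; have := h _ e0.
  rewrite !near_withinE.
  apply: filterS => s /= hs st Js.
  have st0 : s - t != 0 by rewrite subr_eq0.
  rewrite -(ler_pM2l (_ : 0 < `|s - t|)) ?normr_gt0// -normrZ scalerBr.
  rewrite scalerA mulfV// scale1r distrC mulrC; exact: hs.
Qed.

Lemma tangent_withinS V J J' (u : R -> V) t v : J `<=` J' ->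
  tangent_within J' u t v -> tangent_within J u t v.
Proof.
move=> JJ h e e0; have := h _ e0; rewrite !near_withinE.
by apply: filterS => s hs Js; apply: hs; exact: JJ.
Qed.

Lemma tangent_within_lipschitz V J (u : R -> V) t v : tangent_within J u t v ->
  \forall s \near within J (nbhs t), `|u s - u t| <= (1 + `|v|) * `|s - t|.
Proof.
move=> h; have := h 1 ltr01; apply: filterS => s hs.
rewrite -[u s - u t](subrK ((s - t) *: v)); apply: le_trans (ler_normD _ _) _.
by rewrite normrZ mulrDl (mulrC `|v|) lerD.
Qed.

Lemma tangent_within_continuous V J (u : R -> V) t v : tangent_within J u t v ->
  u s @[s --> within J (nbhs t)] --> u t.
Proof.
move=> /tangent_within_lipschitz h; apply/cvgrPdist_le => e e0.
have p : 0 < 1 + `|v| by rewrite ltr_wpDr.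
have hd : \forall s \near within J (nbhs t), `|s - t| <= e / (1 + `|v|).
  by apply: cvg_within; apply: (near_dist_le (V := R^o)); rewrite divr_gt0.
near=> s; rewrite distrC.
apply: (@le_trans _ _ ((1 + `|v|) * `|s - t|)); first by near: s.
by rewrite mulrC -ler_pdivlMr//; near: s.
Unshelve. all: by end_near. Qed.

Lemma quadratic_tangent V J (u : R -> V) t v C :
  (\forall s \near within J (nbhs t),
     `|u s - u t - (s - t) *: v| <= C * `|s - t| ^+ 2) ->
  tangent_within J u t v.
Proof.
move=> h e e0.
have p : 0 < `|C| + 1 by rewrite ltr_wpDl.
have hd : \forall s \near within J (nbhs t), `|s - t| <= e / (`|C| + 1).
  by apply: cvg_within; apply: (near_dist_le (V := R^o)); rewrite divr_gt0.
apply: filterS2 hd h => s; rewrite ler_pdivlMr// => hs h.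
apply: le_trans h _; rewrite expr2 mulrA ler_wpM2r//.
have := ler_norm C; have := normr_ge0 (s - t); nra.
Qed.

End TangentWithin.

Section DerivativeRules.
Context (R : realType).
Implicit Types (U V W : normedModType R) (J : set R).

Lemma tangent_within_cst V J t (c : V) : tangent_within J (fun=> c) t 0.
Proof.
move=> e e0; apply: nearW => s; rewrite scaler0 subrr subr0 normr0.
by rewrite mulr_ge0// ltW.
Qed.

Lemma tangent_withinN V J (u : R -> V) t du : tangent_within J u t du ->
  tangent_within J (fun s => - u s) t (- du).
Proof.
move=> h e e0; have := h _ e0; apply: filterS => s.
by rewrite scalerN -!opprD normrN.
Qed.

Lemma tangent_withinD V J (u v : R -> V) t du dv : tangent_within J u t du ->
  tangent_within J v t dv ->
  tangent_within J (fun s => u s + v s) t (du + dv).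
Proof.
move=> hu hv e e0; have e2 : 0 < e / 2 by rewrite divr_gt0.
have := hv _ e2; have := hu _ e2; apply: filterS2 => s h1 h2.
rewrite scalerDr !opprD (addrACA (u s)) (addrACA (u s - u t)).
rewrite (le_trans (ler_normD _ _))// [e]splitr mulrDl lerD//.
Qed.

(** One product rule for scalar multiplication and for the inner product,
    whose scaling laws belong to different structures; hence the bare function b
    instead of a bundled bilinear map. *)
Lemma tangent_within_bilinear U V W (b : U -> V -> W) J
    (u : R -> U) (v : R -> V) t du dv :
  (forall y, {morph b^~ y : x x' / x - x'}) ->
  (forall x, {morph b x : y y' / y - y'}) ->
  (forall a x y, b (a *: x) y = a *: b x y) ->
  (forall a x y, b x (a *: y) = a *: b x y) ->
  (forall x y, `|b x y| <= `|x| * `|y|) ->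
  tangent_within J u t du -> tangent_within J v t dv ->
  tangent_within J (fun s => b (u s) (v s)) t (b du (v t) + b (u t) dv).
Proof.
move=> bBl bBr bZl bZr bb hu hv e e0.
set c := `|v t| + `|u t| + (1 + `|du|) * (1 + `|dv|).
have c0 : 0 < c.
  by rewrite /c ltr_wpDl ?addr_ge0// mulr_gt0 ?ltr_wpDr.
have ec : 0 < e / c by rewrite divr_gt0.
have nd : \forall s \near within J (nbhs t), `|s - t| <= e / c.
  by apply: cvg_within; apply: (near_dist_le (V := R^o)).
near=> s.
have du1 : `|u s - u t - (s - t) *: du| <= e / c * `|s - t|.
  by near: s; exact: hu.
have dv1 : `|v s - v t - (s - t) *: dv| <= e / c * `|s - t|.
  by near: s; exact: hv.
have du2 : `|u s - u t| <= (1 + `|du|) * `|s - t|.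
  by near: s; exact: tangent_within_lipschitz.
have dv2 : `|v s - v t| <= (1 + `|dv|) * `|s - t|.
  by near: s; exact: tangent_within_lipschitz.
have st : `|s - t| <= e / c by near: s.
have -> : b (u s) (v s) - b (u t) (v t) - (s - t) *: (b du (v t) + b (u t) dv)
  = b (u s - u t - (s - t) *: du) (v t) + b (u t) (v s - v t - (s - t) *: dv)
    + b (u s - u t) (v s - v t).
  rewrite !bBl !bBr bZl bZr scalerDr.
  rewrite [X in _ = X + _]addrACA -[in RHS]opprD [RHS]addrAC; congr (_ - _).
  by rewrite -[RHS]addrA subrKC [RHS]addrC subrKA.
have -> : e * `|s - t| = e / c * `|s - t| * `|v t| + `|u t| * (e / c * `|s - t|)
   + (1 + `|du|) * `|s - t| * ((1 + `|dv|) * (e / c)).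
  have {1}-> : e = e / c * c by rewrite divfK// gt_eqF.
  rewrite /c; ring.
rewrite (le_trans (ler_normD _ _))// lerD//.
  rewrite (le_trans (ler_normD _ _))// lerD//.
    by rewrite (le_trans (bb _ _))// ler_wpM2r.
  by rewrite (le_trans (bb _ _))// ler_wpM2l.
rewrite (le_trans (bb _ _))// ler_pM// (le_trans dv2)// ler_wpM2l//.
Unshelve. all: by end_near. Qed.

Lemma tangent_withinZ V J (a : R -> R) (u : R -> V) t da du :
  tangent_within J a t da -> tangent_within J u t du ->
  tangent_within J (fun s => a s *: u s) t (da *: u t + a t *: du).
Proof.
move=> ha hu; apply: (tangent_within_bilinear
  (b := fun (c : R^o) (x : V) => c *: x)) ha hu => //=.
- by move=> x c c'; rewrite scalerBl.
- by move=> c x x'; rewrite scalerBr.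
- by move=> c c' x; rewrite -scalerA.
- by move=> c c' x; rewrite !scalerA mulrC.
- by move=> c x; rewrite normrZ.
Qed.

Lemma differentiable_remainder V W (F : V -> W) (x : V) (e : R) :
  differentiable F x -> 0 < e ->
  \forall z \near nbhs x, `|F z - F x - 'd F x (z - x)| <= e * `|z - x|.
Proof.
move=> /diff_locallyP[_ /eqaddoP h] e0.
have := h _ e0; rewrite [X in _ -> X]nbhs0P.
apply: filterS => z /=; rewrite (addrC x) addrK.
by rewrite /cst /= opprD addrA.
Qed.

Lemma diff_bounded V W (F : V -> W) (x : V) : differentiable F x ->
  exists2 M : R, 0 < M & forall h, `|'d F x h| <= M * `|h|.
Proof.
move=> dF; have /linear_bounded_continuous/linear_boundedP : continuous ('d F x).
  exact: diff_continuous.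
exact: pinfty_ex_gt0.
Qed.

Lemma tangent_within_comp V W J (F : V -> W) (u : R -> V) t du :
  differentiable F (u t) -> tangent_within J u t du ->
  tangent_within J (fun s => F (u s)) t ('d F (u t) du).
Proof.
move=> dF hu e e0.
have [M M0 hM] := diff_bounded dF.
have c0 : 0 < 1 + `|du| by rewrite ltr_wpDr.
pose e1 := e / 2 / (1 + `|du|); pose e2 := e / 2 / M.
have e10 : 0 < e1 by rewrite !divr_gt0.
have e20 : 0 < e2 by rewrite !divr_gt0.
have h1 : \forall s \near within J (nbhs t),
    `|F (u s) - F (u t) - 'd F (u t) (u s - u t)| <= e1 * `|u s - u t|.
  exact: (tangent_within_continuous hu) (differentiable_remainder dF e10).
near=> s.
have r1 : `|F (u s) - F (u t) - 'd F (u t) (u s - u t)| <= e1 * `|u s - u t|.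
  by near: s.
have r2 : `|u s - u t - (s - t) *: du| <= e2 * `|s - t|.
  by near: s; exact: hu.
have r3 : `|u s - u t| <= (1 + `|du|) * `|s - t|.
  by near: s; exact: tangent_within_lipschitz.
have -> : F (u s) - F (u t) - (s - t) *: 'd F (u t) du =
  (F (u s) - F (u t) - 'd F (u t) (u s - u t)) +
  'd F (u t) (u s - u t - (s - t) *: du).
  have -> : 'd F (u t) (u s - u t - (s - t) *: du) =
      'd F (u t) (u s - u t) - (s - t) *: 'd F (u t) du by rewrite linearB linearZ.
  by rewrite addrA subrK.
rewrite (le_trans (ler_normD _ _))// [e]splitr mulrDl lerD//.
  rewrite (le_trans r1)// (le_trans (ler_wpM2l (ltW e10) r3))//.
  by rewrite mulrA divfK// gt_eqF.
rewrite (le_trans (hM _))// (le_trans (ler_wpM2l (ltW M0) r2))//.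
by rewrite mulrA [M * _]mulrC divfK// gt_eqF.
Unshelve. all: by end_near. Qed.

Lemma tangent_within_derive J (f : R -> R) (t df : R) :
  nbhs t J -> tangent_within J f t df -> is_derive t 1 f df.
Proof.
move=> Jt hf.
suff h : h^-1 *: ((f \o shift t) (h *: 1) - f t) @[h --> 0^'] --> df.
  by apply: DeriveDef; [apply/cvg_ex; exists df | exact: cvg_lim].
apply/cvgrPdist_le => e e0; have := hf _ e0; rewrite !near_withinE => hn.
have : \forall s \near nbhs t, `|f s - f t - (s - t) *: df| <= e * `|s - t|.
  by apply: filterS2 hn Jt => s; exact.
move=> /(@nbhs0P R R^o); apply: filterS => h /=.
rewrite (addrC t) addrK => hh h0.
rewrite -(ler_pM2l (_ : 0 < `|h|)) ?normr_gt0// -normrM mulrBr.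
rewrite [_ *: (_ - _)]/(_ * _) mulrA mulfV// mul1r distrC mulrC.
by rewrite [_ *: 1]mulr1 [df * h]mulrC [_ * e]mulrC; exact: hh.
Qed.

Lemma derive_tangent_within J (f : R -> R) (t df : R) :
  is_derive t 1 f df -> tangent_within J f t df.
Proof.
case=> /cvg_ex[l hl] hd e e0.
have {hd hl} : h^-1 *: ((f \o shift t) (h *: 1) - f t) @[h --> 0^'] --> df.
  by rewrite -hd /derive (cvg_lim _ hl).
move/cvgrPdist_le => /(_ _ e0); rewrite !near_withinE => hn.
suff : \forall s \near nbhs t, `|f s - f t - (s - t) *: df| <= e * `|s - t|.
  by apply: filterS.
apply/(@nbhs0P R R^o); apply: filterS hn => h /=.
have [->|h0 /(_ isT)] := eqVneq h 0.
  by move=> _; rewrite addr0 !subrr scale0r subrr normr0 mulr0.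
rewrite (addrC t) addrK [_ *: 1]mulr1.
rewrite -(ler_pM2l (_ : 0 < `|h|)) ?normr_gt0// -normrM mulrBr.
rewrite [_ *: (_ - _)]/(_ * _) mulrA mulfV// mul1r distrC mulrC.
by rewrite [e * _]mulrC /GRing.scale /= [h * _]mulrC.
Qed.

(** The form in which every differential inequality is used: a one-sided
    derivative at the endpoints of J is enough, as it gives continuity there. *)
Lemma tangent_within_nonincreasing J (f df : R -> R) a b :
  is_interval J -> J a -> J b -> a <= b ->
  (forall t, J t -> tangent_within J f t (df t)) ->
  (forall t, J t -> df t <= 0) -> f b <= f a.
Proof.
move=> Ji Ja Jb ab hf df0.
have sJ t : a <= t <= b -> J t by move=> h; exact: Ji h.
have soJ t : t \in `]a, b[%R -> J t.
  by rewrite in_itv/= => /andP[/ltW at_ /ltW tb]; apply: sJ; rewrite at_ tb.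
have hd t : t \in `]a, b[%R -> is_derive t 1 f (df t).
  move=> /[dup] /soJ Jt tab.
  apply: (tangent_within_derive (J := J)); last exact: hf.
  by have := near_in_itvoo tab; apply: filterS => s; exact: soJ.
apply: (@ler0_derive1_le_cc R f a b) => //.
- by move=> t /hd[].
- move=> t tab; rewrite derive1E; have [_ ->] := hd _ tab.
  by apply: df0; exact: soJ.
- apply/subspace_continuousP => t /=; rewrite in_itv/= => /sJ Jt.
  apply: (tangent_within_continuous (v := df t)).
  apply: tangent_withinS (hf _ Jt) => s /=; rewrite in_itv/=; exact: sJ.
- by rewrite in_itv/= ab lexx.
- by rewrite in_itv/= ab lexx.
Qed.

End DerivativeRules.

(** * Variational inequalities and coercive operators *)

Section VariationalInequality.
Context (R : realType) (H : completeNormedModType R) (ip : {biscalar H}).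
Hypothesis ip_inner : inner_product ip.

Let ipC := ipC ip_inner.
Let ipxx := ipxx ip_inner.
Let ipE := ipE ip.

(** Turns an identity between vectors into one between reals, which [ring] can
    check after expanding the inner products. *)
Lemma ip_inj (x y : H) : (forall v, ip x v = ip y v) -> x = y.
Proof.
move=> h; apply/subr0_eq/normr0_eq0/eqP; rewrite -sqrf_eq0 -ipxx.
by rewrite (linearBl ip) h subrr.
Qed.

(** The variational characterisation of the metric projection onto a closed
    convex set; it is all that the fixed point argument needs to know about K. *)
Definition is_projection (K : set H) (P : H -> H) : Prop :=
  forall x, K (P x) /\ forall v, K v -> ip (x - P x) (v - P x) <= 0.

Lemma projection_nonexpansive K P x y : is_projection K P ->
  `|P x - P y| <= `|x - y|.
Proof.
move=> hP; have [Kx hx] := hP x; have [Ky hy] := hP y.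
have := hx _ Ky; have := hy _ Kx.
have [->|n0 h1 h2] := eqVneq `|P x - P y| 0; first by rewrite normr_ge0.
have p : 0 < `|P x - P y| by rewrite lt_def n0 /=.
rewrite -(ler_pM2r p) -expr2; apply: le_trans (Cauchy_Schwarz ip_inner _ _).
rewrite -ipxx; move: h1 h2; rewrite !ipE (ipC (P y) (P x)); lra.
Qed.

(** Fixed points of the map sending x to P (x - tau G x) are the solutions, and
    this map contracts when tau is small, since P does not expand distances and
    strong monotonicity beats the Lipschitz constant of G. *)
Lemma strongly_monotone_variational_inequality (K : set H) (P G : H -> H)
    (m L : R) :
  closed K -> is_projection K P -> 0 < m ->
  (forall x y, K x -> K y -> `|G x - G y| <= L * `|x - y|) ->
  (forall x y, K x -> K y -> m * `|x - y| ^+ 2 <= ip (G x - G y) (x - y)) ->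
  exists2 x, K x & forall v, K v -> 0 <= ip (G x) (v - x).
Proof.
move=> Kcl hP m0 GL Gm.
(* Adding m makes the Lipschitz constant positive and at least m. *)
pose N := `|L| + m; have N0 : 0 < N by rewrite ltr_wpDl.
have GN x y : K x -> K y -> `|G x - G y| <= N * `|x - y|.
  move=> Kx Ky; apply: le_trans (GL _ _ Kx Ky) _; rewrite ler_wpM2r//.
  by rewrite /N (le_trans (ler_norm L))// lerDl ltW.
(* This tau minimises 1 - 2 tau m + (tau N)^2, the bound for the square of the
   contraction factor; the minimum is 1 - k, and q = 1 - k / 2 dominates its
   square root. *)
pose tau := m / N ^+ 2.
have tau0 : 0 < tau by rewrite divr_gt0// exprn_gt0.
pose T x := P (x - tau *: G x).
pose k := (m / N) ^+ 2.
have k0 : 0 < k by rewrite exprn_gt0// divr_gt0.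
have k1 : k <= 1.
  rewrite /k expr_le1// ?divr_ge0 ?(ltW m0) ?(ltW N0)//.
  by rewrite ler_pdivrMr// mul1r /N lerDr.
pose q := 1 - k / 2.
have q0 : 0 <= q by rewrite /q; lra.
have TT x y : K x -> K y -> `|T x - T y| <= q * `|x - y|.
  move=> Kx Ky; apply: le_trans (projection_nonexpansive _ _ hP) _.
  rewrite -ler_sqr ?nnegrE ?mulr_ge0// exprMn.
  have -> : x - tau *: G x - (y - tau *: G y) = (x - y) - tau *: (G x - G y).
    by apply: ip_inj => v; rewrite !ipE; ring.
  rewrite (normB2 ip_inner) ipZr (ipC (x - y)) normrZ exprMn.
  have h1 := Gm _ _ Kx Ky.
  have h2 : `|G x - G y| ^+ 2 <= N ^+ 2 * `|x - y| ^+ 2.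
    by rewrite -exprMn ler_sqr ?nnegrE ?GN// mulr_ge0// ltW.
  have e1 : tau * m = k by rewrite /tau /k exprMn exprVn expr2; ring.
  have e2 : tau ^+ 2 * N ^+ 2 = k.
    rewrite /tau /k; field; exact: lt0r_neq0.
  have h3 : tau * (m * `|x - y| ^+ 2) <= tau * ip (G x - G y) (x - y).
    by rewrite ler_pM2l.
  have h4 : tau ^+ 2 * `|G x - G y| ^+ 2 <= k * `|x - y| ^+ 2.
    by rewrite -e2 -mulrA ler_pM2l// exprn_gt0.
  rewrite mulrA e1 in h3; rewrite real_normK ?num_real//.
  have h5 : 0 <= k ^+ 2 * `|x - y| ^+ 2 by rewrite mulr_ge0// sqr_ge0.
  by rewrite /q; nra.
have TK : set_fun K K T by move=> x _; exact: (hP _).1.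
have ctr : is_contraction (mkfun_fun TK).
  exists (NngNum q0); split; first by rewrite /= /q; lra.
  by move=> [x y] /= [Kx Ky]; exact: TT.
have [|x Kx xT] := banach_fixed_point ctr Kcl.
  by exists (P 0); exact: (hP _).1.
exists x => // v Kv.
have := (hP (x - tau *: G x)).2 _ Kv.
rewrite -[P _]/(T x) -[T x]xT.
have -> : x - tau *: G x - x = - (tau *: G x) by rewrite addrAC subrr add0r.
by rewrite linearNl oppr_le0 ipZl pmulr_rge0.
Qed.

(** Surjectivity is the previous result on the whole space, where the projection
    is the identity and the inequality is an equation. *)
Lemma coercive_linear_bijective (A : {linear H -> H}) (m : R) :
  continuous A -> 0 < m -> (forall x, m * `|x| ^+ 2 <= ip (A x) x) ->
  bijective A.
Proof.
move=> cA m0 Am.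
have [M [M0 hM]] : exists M : R, 0 < M /\ forall h, `|A h| <= M * `|h|.
  move/linear_bounded_continuous/linear_boundedP/pinfty_ex_gt0: cA => [M ? ?].
  by exists M.
have Ainj x : A x = 0 -> x = 0.
  move=> Ax; apply/normr0_eq0/eqP; rewrite -sqrf_eq0.
  have := Am x; rewrite Ax linear0l pmulr_rle0// => h.
  by rewrite eq_le h sqr_ge0.
have Asurj z : exists x, A x = z.
  have pT : is_projection setT id.
    by move=> x; split=> // v _; rewrite subrr linear0l.
  have [||x _ hx] := strongly_monotone_variational_inequality
    (G := fun x => A x - z) (L := M) closedT pT m0.
  - by move=> x y _ _; rewrite opprB addrA subrK -linearB hM.
  - by move=> x y _ _; rewrite opprB addrA subrK -linearB Am.
  exists x; apply/subr0_eq/normr0_eq0/eqP; rewrite -sqrf_eq0 -ipxx.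
  have := hx (x - (A x - z)) I; rewrite addrAC subrr add0r linearNr oppr_ge0.
  by rewrite eq_le => ->; rewrite ipxx sqr_ge0.
have [B hB] := choice Asurj.
exists B => x; last exact: hB.
by apply/subr0_eq/Ainj; rewrite linearB hB subrr.
Qed.

Definition ball_proj (c : H) (rho : R) (x : H) : H :=
  if `|x - c| <= rho then x else c + (rho / `|x - c|) *: (x - c).

Lemma ball_projP c rho : 0 <= rho ->
  is_projection (cball c rho) (ball_proj c rho).
Proof.
move=> rho0 x; rewrite /ball_proj.
have [xin|xout] := leP `|x - c| rho; first by split=> // v _; rewrite subrr linear0l.
have n0 : 0 < `|x - c| by exact: le_lt_trans xout.
set l := rho / _; have l0 : 0 <= l by rewrite divr_ge0.
have ln : l * `|x - c| = rho by rewrite divfK// gt_eqF.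
split.
  by rewrite /cball /= addrAC subrr add0r normrZ ger0_norm// ln.
move=> v; rewrite /cball /= => hv.
have -> : x - (c + l *: (x - c)) = (1 - l) *: (x - c).
  by apply: ip_inj => w; rewrite !ipE; ring.
have -> : v - (c + l *: (x - c)) = (v - c) - l *: (x - c) by rewrite opprD addrA.
rewrite ipZl linearBr ipZr ipxx.
have l1 : l <= 1 by rewrite ler_pdivrMr// mul1r ltW.
rewrite mulr_ge0_le0 ?subr_ge0// subr_le0 expr2 mulrA ln mulrC.
apply: le_trans (Cauchy_Schwarz ip_inner _ _) _.
by rewrite ler_wpM2l.
Qed.

Lemma cball_closed (c : H) (rho : R) : closed (cball c rho).
Proof.
have -> : cball c rho = (fun x => `|x - c|) @^-1` [set t : R | t <= rho] by [].
apply: closed_comp; last exact: closed_le.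
move=> x _; apply: (@continuous_comp _ _ _ (fun x => x - c) (fun x => `|x|)).
  by apply: continuousB => //; exact: cst_continuous.
exact: norm_continuous.
Qed.

End VariationalInequality.

(** * Euler's scheme for Lipschitz differential equations *)

Section EulerScheme.
Context (R : realType) (X : completeNormedModType R).
Variables (G : R -> X -> X) (L : R) (x0 : X).
Hypothesis L0 : 0 < L.
Hypothesis GL : forall s t x z, 0 <= s -> 0 <= t ->
  `|G s x - G t z| <= L * (`|s - t| + `|x - z|).

Fixpoint euler (h : R) (k : nat) : X :=
  if k is k'.+1 then euler h k' + h *: G (k'%:R * h) (euler h k') else x0.

Let slope h k := G (k%:R * h) (euler h k).

Lemma discrete_Gronwall (a : nat -> R) (h a0 b : R) (k : nat) : 0 < h ->
  0 <= a0 -> 0 <= b -> a 0%N <= a0 ->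
  (forall j, (j < k)%N -> a j.+1 <= (1 + h * L) * a j + h * b) ->
  a k <= (a0 + b / L) * expR (L * (k%:R * h)).
Proof.
move=> h0 a00 b0 ha0 ha; have c0 : 0 <= b / L by rewrite divr_ge0// ltW.
suff : a k + b / L <= (a0 + b / L) * expR (L * (k%:R * h)).
  by apply: le_trans; rewrite lerDl.
elim: k ha => [_|k IH ha].
  by rewrite mul0r mulr0 expR0 mulr1 lerD2r.
have {}IH := IH (fun j jk => ha j (ltnW jk)).
have -> : L * (k.+1%:R * h) = L * (k%:R * h) + h * L by rewrite -natr1; ring.
rewrite expRD mulrA.
apply: (@le_trans _ _ ((1 + h * L) * (a k + b / L))).
  rewrite mulrDr addrC -lerBrDl; apply: le_trans (ha k (ltnSn k)) _.
  have -> : (1 + h * L) * (b / L) = b / L + h * b by field; exact: lt0r_neq0.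
  by lra.
have e1 : 1 + h * L <= expR (h * L) by exact: expR_ge1Dx.
have p1 : 0 <= 1 + h * L by rewrite addr_ge0// mulr_ge0// ltW.
apply: (@le_trans _ _ ((1 + h * L) * ((a0 + b / L) * expR (L * (k%:R * h))))).
  by rewrite ler_wpM2l.
by rewrite mulrC ler_wpM2l// mulr_ge0 ?expR_ge0// addr_ge0.
Qed.

Let V T := (`|G 0 x0| + 1) * expR (L * T).

Let V_ge1 T : 0 <= T -> 1 <= V T.
Proof.
move=> T0; rewrite /V -[1]mulr1 ler_pM//.
  by rewrite mulr1 lerDr.
by rewrite -expR0 ler_expR mulr_ge0// ltW.
Qed.

Let time_ge0 (h : R) (k : nat) : 0 < h -> 0 <= k%:R * h.
Proof. by move=> h0; rewrite mulr_ge0// ltW. Qed.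

Let eulerS h k : euler h k.+1 - euler h k = h *: slope h k.
Proof. by rewrite /= addrAC subrr add0r. Qed.

(** The slopes themselves obey a Gronwall recurrence, because consecutive points
    are at distance h times the slope; the constant depends on T only, not on
    the mesh. *)
Lemma slope_bound h k T : 0 < h -> k%:R * h <= T -> `|slope h k| + 1 <= V T.
Proof.
move=> h0 hk.
have := @discrete_Gronwall (fun k => `|slope h k| + 1) h (`|G 0 x0| + 1) 0 k h0
  _ (lexx 0).
rewrite mul0r addr0 => hG; apply: (le_trans (hG _ _ _)) => [|/=|j _|].
- by rewrite addr_ge0.
- by rewrite /slope mul0r.
- rewrite mulr0 addr0.
  have := GL (euler h j.+1) (euler h j) (time_ge0 j.+1 h0) (time_ge0 j h0).
  rewrite eulerS normrZ (gtr0_norm h0).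
  have -> : j.+1%:R * h - j%:R * h = h by rewrite -natr1; ring.
  rewrite (gtr0_norm h0) => hs.
  have := ler_normD (slope h j.+1 - slope h j) (slope h j).
  rewrite subrK; move: hs; rewrite -!/(slope _ _) /=; lra.
by rewrite /V ler_wpM2l ?addr_ge0// ler_expR ler_pM2l.
Qed.

Lemma euler_increment h k j T : 0 < h -> (k + j)%:R * h <= T ->
  `|euler h (k + j)%N - euler h k| <= j%:R * h * V T.
Proof.
move=> h0; elim: j => [|j IH] hT; first by rewrite addn0 subrr normr0 !mul0r.
have hT' : (k + j)%:R * h <= T.
  by apply: le_trans hT; rewrite ler_pM2r// ler_nat addnS.
have -> : euler h (k + j.+1)%N - euler h k =
    h *: slope h (k + j)%N + (euler h (k + j)%N - euler h k).
  by rewrite -eulerS addnS addrA subrK.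
apply: le_trans (ler_normD _ _) _; rewrite normrZ (gtr0_norm h0).
have := slope_bound h0 hT'; have := IH hT'; rewrite -natr1; nra.
Qed.

Lemma euler_consistency h k j T : 0 < h -> (k + j)%:R * h <= T ->
  `|euler h (k + j)%N - euler h k - (j%:R * h) *: slope h k|
    <= L * V T * (j%:R * h) ^+ 2.
Proof.
move=> h0; elim: j => [|j IH] hT.
  by rewrite addn0 subrr mul0r scale0r subrr normr0 expr0n mulr0.
have hT' : (k + j)%:R * h <= T.
  by apply: le_trans hT; rewrite ler_pM2r// ler_nat addnS.
have -> : euler h (k + j.+1)%N - euler h k - (j.+1%:R * h) *: slope h k =
   h *: (slope h (k + j)%N - slope h k) +
   (euler h (k + j)%N - euler h k - (j%:R * h) *: slope h k).
  rewrite addnS -natr1 mulrDl mul1r scalerDl scalerBr [RHS]addrACA.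
  rewrite -[in RHS]opprD (addrC (h *: slope h k)); congr (_ - _).
  by rewrite addrCA addrA.
apply: le_trans (ler_normD _ _) _; rewrite normrZ (gtr0_norm h0).
have hs := GL (euler h (k + j)%N) (euler h k) (time_ge0 (k + j) h0) (time_ge0 k h0).
have jh : 0 <= j%:R * h by exact: time_ge0.
have e : (k + j)%:R * h - k%:R * h = j%:R * h by rewrite natrD; ring.
rewrite e ger0_norm// in hs.
have hi := euler_increment h0 hT'.
have V1 : 1 <= V T by rewrite V_ge1// (le_trans _ hT)// time_ge0.
have := IH hT'; rewrite -!/(slope _ _) in hs *.
have h2 : `|slope h (k + j)%N - slope h k| <= L * (j%:R * h + j%:R * h * V T).
  by apply: le_trans hs _; rewrite ler_pM2l// lerD2l.
have h3 : h * `|slope h (k + j)%N - slope h k| <= h * (L * (j%:R * h + j%:R * h * V T)).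
  by rewrite ler_pM2l.
have h4 : 0 <= h * L * (j%:R * h) * (V T - 1).
  by rewrite mulr_ge0 ?subr_ge0// mulr_ge0// mulr_ge0 ?ltW.
have h5 : 0 <= h * L * h * V T.
  by rewrite mulr_ge0 ?(le_trans ler01 V1)// !mulr_ge0 ?ltW.
rewrite -natr1; move: h3 h4 h5; nra.
Qed.


(** Two half steps differ from one step by the variation of the slope over half
    a step, which is of order h^2; Gronwall sums these errors to order h. *)
Lemma euler_refine h k T : 0 < h -> k%:R * h <= T ->
  `|euler (h / 2) k.*2 - euler h k| <= h * (V T / 4) * expR (L * T).
Proof.
move=> h0 hk; have T0 : 0 <= T by apply: le_trans hk; exact: time_ge0.
have h20 : 0 < h / 2 by rewrite divr_gt0.
have V0 : 0 <= V T by rewrite (le_trans ler01)// V_ge1.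
have tE j : j.*2%:R * (h / 2) = j%:R * h by rewrite -muln2 natrM; field.
have := @discrete_Gronwall (fun j => `|euler (h / 2) j.*2 - euler h j|) h 0
  (h * L * V T / 4) k h0 (lexx 0).
rewrite add0r => hG; apply: (le_trans (hG _ _ _)) => {hG} [||j jk|].
- by rewrite divr_ge0// mulr_ge0// mulr_ge0 ?ltW.
- by rewrite /= subrr normr0.
- have hj : j.+1%:R * h <= T.
    by apply: le_trans hk; rewrite ler_pM2r// ler_nat.
  have hj' : j.*2%:R * (h / 2) <= T.
    by rewrite tE; apply: le_trans hj; rewrite ler_pM2r// ler_nat.
  have -> : euler (h / 2) j.+1.*2 - euler h j.+1 =
      (euler (h / 2) j.*2 - euler h j) +
      h *: (slope (h / 2) j.*2 - slope h j) +
      (h / 2) *: (slope (h / 2) j.*2.+1 - slope (h / 2) j.*2).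
    have -> : h *: (slope (h / 2) j.*2 - slope h j) = (h / 2) *: slope (h / 2) j.*2
        + ((h / 2) *: slope (h / 2) j.*2 - h *: slope h j).
      by rewrite scalerBr {1}[h]splitr scalerDl addrA.
    rewrite scalerBr doubleS /= -!/(slope _ _).
    rewrite -[RHS]addrA [X in _ = _ + X]addrC [X in _ = _ + X]addrA subrK.
    rewrite [X in _ = _ + X]addrA addrACA -opprD; congr (_ - _).
    by rewrite -addrA [X in _ = _ + X]addrC.
  have s1 : `|slope (h / 2) j.*2 - slope h j| <=
      L * `|euler (h / 2) j.*2 - euler h j|.
    rewrite /slope tE; apply: le_trans (GL _ _ _ _) _; rewrite ?time_ge0//.
    by rewrite subrr normr0 add0r.
  have s2 : `|slope (h / 2) j.*2.+1 - slope (h / 2) j.*2| <= L * (h / 2 * V T).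
    apply: le_trans (GL _ _ (time_ge0 _ h20) (time_ge0 _ h20)) _.
    rewrite eulerS normrZ (gtr0_norm h20) ler_pM2l//.
    have -> : j.*2.+1%:R * (h / 2) - j.*2%:R * (h / 2) = h / 2.
      by rewrite -natr1; ring.
    rewrite (gtr0_norm h20); have := slope_bound h20 hj'; nra.
  rewrite (le_trans (ler_normD _ _))//.
  have := ler_normD (euler (h / 2) j.*2 - euler h j)
      (h *: (slope (h / 2) j.*2 - slope h j)).
  rewrite (normrZ h) (normrZ (h / 2)) (gtr0_norm h20) (gtr0_norm h0).
  have : h * `|slope (h / 2) j.*2 - slope h j| <=
      h * (L * `|euler (h / 2) j.*2 - euler h j|) by rewrite ler_pM2l.
  have : h / 2 * `|slope (h / 2) j.*2.+1 - slope (h / 2) j.*2| <=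
      h / 2 * (L * (h / 2 * V T)) by rewrite ler_pM2l.
  lra.
have -> : h * L * V T / 4 / L = h * (V T / 4) by field; exact: lt0r_neq0.
by rewrite ler_wpM2l// ?ler_expR ?ler_pM2l// mulr_ge0 ?divr_ge0// ltW.
Qed.

Let mesh (n : nat) : R := 2^-1 ^+ n.

Let mesh_gt0 n : 0 < mesh n.
Proof. by rewrite exprn_gt0. Qed.

Let mesh_le1 n : mesh n <= 1.
Proof. by rewrite exprn_ile1// invf_le1 ?ler1n. Qed.

Let meshS n : mesh n.+1 = mesh n / 2.
Proof. by rewrite /mesh exprSr. Qed.

Lemma mesh_small (C e : R) : 0 < e -> exists n, C * mesh n <= e.
Proof.
move=> e0.
have h : geometric C (2^-1 : R) n @[n --> \oo] --> 0.
  by apply: cvg_geometric; rewrite ger0_norm// invf_lt1// ltr1n.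
have /cvgrPdist_le/(_ _ e0)[n _ hn] := h.
exists n; have := hn n (leqnn n); rewrite sub0r normrN.
by apply: le_trans; rewrite ler_norm.
Qed.

(** The bound on the distance to the limit is uniform in whatever parameter z
    depends on; the limit of the schemes inherits their regularity through it. *)
Lemma geometric_steps_cvg (z : nat -> X) (C : R) :
  (forall n, `|z n.+1 - z n| <= C * mesh n) ->
  exists l : X, forall n, `|l - z n| <= 2 * C * mesh n.
Proof.
move=> hz.
have hzm n m : `|z (n + m)%N - z n| <= 2 * C * mesh n - 2 * C * mesh (n + m).
  elim: m => [|m IH]; first by rewrite addn0 !subrr normr0.
  rewrite addnS -[z _ - z n](subrKA (z (n + m)%N)) addrC.
  apply: le_trans (ler_normD _ _) _; rewrite addrC.
  have := hz (n + m)%N; rewrite meshS; move: IH; lra.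
have C0 : 0 <= C.
  by have := le_trans (normr_ge0 _) (hz 0%N); rewrite /mesh expr0 mulr1.
have hz2 n m : `|z (n + m)%N - z n| <= 2 * C * mesh n.
  apply: le_trans (hzm n m) _.
  by rewrite gerBl// mulr_ge0 ?mulr_ge0// ltW.
have cz : cvgn z.
  apply/cauchy_cvgP/cauchy_exP => e e0.
  have e2 : 0 < e / 2 by rewrite divr_gt0.
  have [n hn] := mesh_small (2 * C) e2.
  exists (z n); exists n => // m /= nm.
  rewrite -ball_normE /ball_ /= distrC -(subnKC nm).
  apply: le_lt_trans (hz2 _ _) (le_lt_trans hn _).
  by rewrite ltr_pdivrMr// ltr_pMr// ltr1n.
exists (limn z) => n.
apply/ler_addgt0Pr => e e0.
have /cvgrPdist_le/(_ _ e0)[N _ hN] := cz.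
rewrite -(subrKA (z (n + N)%N)); apply: le_trans (ler_normD _ _) _.
rewrite addrC lerD//; apply: hN; exact: leq_addl.
Qed.

Let step n t := Num.truncn (t / mesh n).

Let step_itv n t : 0 <= t ->
  (step n t)%:R * mesh n <= t < (step n t)%:R * mesh n + mesh n.
Proof.
move=> t0; have /truncn_itv/andP[] : 0 <= t / mesh n by rewrite divr_ge0// ltW.
by rewrite ler_pdivlMr// ltr_pdivrMr// -natr1 mulrDl mul1r => -> ->.
Qed.

Let stepS n t : 0 <= t -> exists2 j, (j <= 1)%N & step n.+1 t = ((step n t).*2 + j)%N.
Proof.
move=> t0; have /andP[h1 h2] := step_itv n t0.
have /andP[h3 h4] := step_itv n.+1 t0.
rewrite meshS in h3 h4.
have m0 : 0 < mesh n by [].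
have l1 : ((step n t).*2 < (step n.+1 t).+1)%N.
  rewrite -(ltr_nat R) -(ltr_pM2r m0) -muln2 natrM -natr1; lra.
have l2 : (step n.+1 t < (step n t).*2.+2)%N.
  rewrite -(ltr_nat R) -(ltr_pM2r m0) -muln2 -!natr1 natrM; lra.
exists (step n.+1 t - (step n t).*2)%N; last by rewrite subnKC.
by rewrite leq_subLR addn1.
Qed.

(** Schemes of mesh 2^-n, read as step functions, form a Cauchy sequence at each
    time.  Step functions spare the interpolation by polygons. *)
Lemma euler_limit : exists x : R -> X, forall T t n, 0 <= t -> t <= T ->
  `|x t - euler (mesh n) (step n t)| <=
  2 * (V T / 4 * expR (L * T) + V T / 2) * mesh n.
Proof.
suff h t : exists l : X, 0 <= t -> forall n, 
    `|l - euler (mesh n) (step n t)| <=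
    2 * (V t / 4 * expR (L * t) + V t / 2) * mesh n.
  have [x hx] := choice h; exists x => T t n t0 tT.
  apply: le_trans (hx _ t0 n) _.
  have e : expR (L * t) <= expR (L * T) by rewrite ler_expR ler_pM2l.
  have v : V t <= V T by rewrite /V ler_wpM2l// addr_ge0.
  have v1 := V_ge1 t0.
  have e0 := expR_ge0 (L * t).
  rewrite ler_pM2r// ler_pM2l// lerD ?ler_pM2r// ler_pM// ?ler_pM2r// divr_ge0//.
  exact: le_trans v1.
have [t0|/negP t0] := boolP (0 <= t); last by exists 0.
have [|l hl] := @geometric_steps_cvg (fun n => euler (mesh n) (step n t))
  (V t / 4 * expR (L * t) + V t / 2).
  move=> n; have [j j1 ->] := stepS n t0.
  have /andP[kt _] := step_itv n t0.
  have h20 : 0 < mesh n / 2 by rewrite divr_gt0.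
  rewrite meshS -(subrKA (euler (mesh n / 2) (step n t).*2)).
  apply: le_trans (ler_normD _ _) _; rewrite mulrDl addrC lerD//.
    by rewrite [leRHS]mulrC [leRHS]mulrA; apply: euler_refine.
  have V0 : 0 <= V t by rewrite (le_trans ler01)// V_ge1.
  case: j j1 => [|[|//]] _.
    by rewrite addn0 subrr normr0 mulr_ge0 ?divr_ge0// ltW.
  rewrite addn1 eulerS normrZ gtr0_norm//.
  have := @slope_bound (mesh n / 2) (step n t).*2 t h20.
  have -> : (step n t).*2%:R * (mesh n / 2) = (step n t)%:R * mesh n.
    by rewrite -muln2 natrM; field.
  by move=> /(_ kt); have := mesh_gt0 n; nra.
by exists l.
Qed.

(** Both estimates hold for the schemes up to an error of the order of the mesh,
    so they pass to the limit.  The second is quadratic in t - s and contains the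
    differential equation. *)
Lemma euler_limit_increments (x : R -> X) :
  (forall T t n, 0 <= t -> t <= T ->
    `|x t - euler (mesh n) (step n t)| <=
    2 * (V T / 4 * expR (L * T) + V T / 2) * mesh n) ->
  forall T s t, 0 <= s -> s <= t -> t <= T ->
    `|x t - x s| <= (t - s) * V T /\
    `|x t - x s - (t - s) *: G s (x s)| <= L * V T * (t - s) ^+ 2.
Proof.
move=> hx T s t s0 st tT; have t0 := le_trans s0 st; have T0 := le_trans t0 tT.
have sT := le_trans st tT.
pose d := 2 * (V T / 4 * expR (L * T) + V T / 2).
have {}hx r n : 0 <= r -> r <= T -> `|x r - euler (mesh n) (step n r)| <= d * mesh n.
  exact: hx.
have V1 := V_ge1 T0.
have LV : 0 <= L * V T by rewrite mulr_ge0 ?ltW// (lt_le_trans ltr01).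
have ts : 0 <= t - s by rewrite subr_ge0.
(* Grid indices k and k + j of the steps which contain s and t. *)
have key n : exists k j,
  [/\ `|x s - euler (mesh n) k| <= d * mesh n,
      `|x t - euler (mesh n) (k + j)%N| <= d * mesh n,
      (k + j)%:R * mesh n <= T,
      `|j%:R * mesh n - (t - s)| <= mesh n & `|k%:R * mesh n - s| <= mesh n].
  have kl : (step n s <= step n t)%N.
    rewrite /step truncn_ge_nat ?divr_ge0 ?(ltW (mesh_gt0 n))//.
    apply: (@le_trans _ _ (s / mesh n)); last by rewrite ler_pM2r ?invr_gt0.
    by rewrite truncn_le divr_ge0// ltW.
  exists (step n s), (step n t - step n s)%N; rewrite subnKC//.
  have /andP[k1 k2] := step_itv n s0; have /andP[l1 l2] := step_itv n t0.
  split; [exact: hx|exact: hx|exact: le_trans l1 _| |].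
  - by rewrite natrB// mulrBl ler_norml; apply/andP; split; lra.
  - by rewrite ler_norml; apply/andP; split; lra.
split.
  apply/ler_addgt0Pr => e e0.
  have [n hn] := mesh_small (2 * d + V T) e0; apply: le_trans (lerD (lexx _) hn).
  have [k [j [h1 h2 h3 h4 _]]] := key n.
  have -> : x t - x s = (x t - euler (mesh n) (k + j)%N) +
    (euler (mesh n) (k + j)%N - euler (mesh n) k) - (x s - euler (mesh n) k).
    by rewrite subrKA opprB subrKA.
  apply: le_trans (ler_normB _ _) _.
  have := ler_normD (x t - euler (mesh n) (k + j)) 
    (euler (mesh n) (k + j) - euler (mesh n) k).
  have := euler_increment (mesh_gt0 n) h3.
  have : j%:R * mesh n * V T <= (t - s + mesh n) * V T.
    rewrite ler_pM2r ?(lt_le_trans ltr01)//.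
    by have := ler_norm (j%:R * mesh n - (t - s)); lra.
  lra.
apply/ler_addgt0Pr => e e0.
have [n hn] := mesh_small
  (2 * d + L * V T * (2 * (t - s) + 1) + V T + (t - s) * (L * (1 + d))) e0.
apply: le_trans (lerD (lexx _) hn).
have [k [j [h1 h2 h3 h4 h5]]] := key n.
set h := mesh n in h1 h2 h3 h4 h5 *.
have h0 : 0 < h by exact: mesh_gt0.
have hh1 : h <= 1 by exact: mesh_le1.
have -> : x t - x s - (t - s) *: G s (x s) =
  (x t - euler h (k + j)%N) - (x s - euler h k) +
  (euler h (k + j)%N - euler h k - (j%:R * h) *: slope h k) +
  ((j%:R * h - (t - s)) *: slope h k + (t - s) *: (slope h k - G s (x s))).
  have -> : (j%:R * h - (t - s)) *: slope h k =
      (j%:R * h) *: slope h k - (t - s) *: slope h k by rewrite scalerBl.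
  rewrite scalerBr subrKA [RHS]addrA; congr (_ - _).
  rewrite [X in _ = X + _]addrA subrK.
  by rewrite opprB addrAC !subrKA.
apply: le_trans (ler_normD _ _) _.
have n1 := ler_normB (x t - euler h (k + j)%N) (x s - euler h k).
have n2 := ler_normD (x t - euler h (k + j)%N - (x s - euler h k))
  (euler h (k + j)%N - euler h k - (j%:R * h) *: slope h k).
have n3 := ler_normD ((j%:R * h - (t - s)) *: slope h k)
  ((t - s) *: (slope h k - G s (x s))).
have c1 := euler_consistency h0 h3.
have kh : k%:R * h <= T.
  by apply: le_trans h3; rewrite ler_pM2r// ler_nat leq_addr.
have jh : j%:R * h <= t - s + h.
  by have := ler_norm (j%:R * h - (t - s)); lra.
have c2 : L * V T * (j%:R * h) ^+ 2 <= L * V T * (t - s + h) ^+ 2.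
  by rewrite ler_wpM2l// ler_sqr// nnegrE ?time_ge0// addr_ge0// ltW.
have c3 : L * V T * (t - s + h) ^+ 2 <=
    L * V T * ((t - s) ^+ 2 + (2 * (t - s) + 1) * h).
  by rewrite ler_wpM2l//; nra.
have c4 : `|(j%:R * h - (t - s)) *: slope h k| <= h * V T.
  rewrite normrZ ler_pM//; have := slope_bound h0 kh; lra.
have c5 : `|(t - s) *: (slope h k - G s (x s))| <= (t - s) * (L * (h + d * h)).
  rewrite normrZ ger0_norm// ler_wpM2l//.
  apply: le_trans (GL _ _ (time_ge0 k h0) s0) _.
  by rewrite ler_pM2l// lerD// distrC.
lra.
Qed.

(** The global form of the Cauchy-Lipschitz theorem, for vector fields which are
    Lipschitz in time and space. *)
Theorem lipschitz_ode_solution : exists x : R -> X, x 0 = x0 /\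
  forall t, 0 <= t -> tangent_within `[0, +oo[ x t (G t (x t)).
Proof.
have [x hx] := euler_limit; have hi := euler_limit_increments hx.
exists x; split.
  apply/subr0_eq/normr0_eq0/eqP; rewrite -normr_le0.
  apply/ler_addgt0Pr => e e0; rewrite add0r.
  have [n hn] := mesh_small (2 * (V 0 / 4 * expR (L * 0) + V 0 / 2)) e0.
  apply: le_trans hn; apply: le_trans (hx 0 0 n _ _) => //.
  by rewrite /step mul0r truncn0 normr_id.
move=> t t0; have t10 : 0 <= t + 1 by rewrite addr_ge0.
have V1 := V_ge1 t10; set W := V (t + 1) in V1.
apply: (quadratic_tangent (C := L * W + L * (1 + W))).
rewrite near_withinE.
have := near_dist_le (t : R^o) ltr01; apply: filterS => s.
rewrite ler_norml => /andP[s1 s2]; rewrite /= in_itv/= andbT => s0.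
have sT : s <= t + 1 by lra.
have tT : t <= t + 1 by lra.
have c0 : 0 <= L * (1 + W) by rewrite mulr_ge0// ?ltW//; lra.
have [ts|/ltW st] := leP t s.
  rewrite ger0_norm ?subr_ge0//; apply: le_trans (hi _ _ _ t0 ts sT).2 _.
  by rewrite ler_wpM2r ?sqr_ge0// lerDl.
have [h1 h2] := hi _ _ _ s0 st tT.
have -> : x s - x t - (s - t) *: G t (x t) =
  - ((x t - x s - (t - s) *: G s (x s)) - (t - s) *: (G t (x t) - G s (x s))).
  have -> : (t - s) *: (G t (x t) - G s (x s)) =
      (t - s) *: G t (x t) - (t - s) *: G s (x s) by rewrite scalerBr.
  rewrite [X in _ = - (_ + X)]opprB subrKA opprB -(opprB t s) scaleNr opprK.
  by rewrite addrC opprB.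
rewrite normrN; apply: le_trans (ler_normB _ _) _.
rewrite normrZ (distrC s t) (ger0_norm (_ : 0 <= t - s)) ?subr_ge0//.
rewrite [leRHS]mulrDl lerD//.
have -> : L * (1 + W) * (t - s) ^+ 2 = (t - s) * (L * ((t - s) + (t - s) * W)).
  by ring.
rewrite ler_wpM2l ?subr_ge0//; apply: le_trans (GL _ _ t0 s0) _.
by rewrite ler_pM2l// ger0_norm ?subr_ge0// lerD2l.
Qed.

End EulerScheme.

(** * Derivatives of monotone operators *)

Section MonotoneOperator.
Context (R : realType) (H : completeNormedModType R) (ip : {biscalar H}).
Hypothesis ip_inner : inner_product ip.

Let ipC := ipC ip_inner.
Let ipxx := ipxx ip_inner.
Let ipE := ipE ip.

Lemma tangent_within_affine (V : normedModType R) J (w v : V) (t : R) :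
  tangent_within J (fun s => w + s *: v) t v.
Proof.
move=> e e0; apply: nearW => s.
by rewrite opprD addrACA subrr add0r -scalerBl subrr normr0 mulr_ge0// ltW.
Qed.

Lemma tangent_within_ip J (u v : R -> H) t du dv :
  tangent_within J u t du -> tangent_within J v t dv ->
  tangent_within J (fun s => ip (u s) (v s)) t (ip du (v t) + ip (u t) dv : R^o).
Proof.
apply: (@tangent_within_bilinear R H H R^o (fun x y => ip x y)).
- by move=> y x x'; rewrite linearBl.
- by move=> x y y'; rewrite linearBr.
- by move=> a x y; rewrite ipZl.
- by move=> a x y; rewrite ipZr.
- exact: Cauchy_Schwarz_abs.
Qed.

Lemma tangent_within_norm2 J (u : R -> H) t du : tangent_within J u t du ->
  tangent_within J (fun s => `|u s| ^+ 2) t (2 * ip (u t) du : R^o).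
Proof.
move=> h; have := tangent_within_ip h h.
have -> : ip du (u t) + ip (u t) du = 2 * ip (u t) du by rewrite (ipC du); ring.
by move=> h2 e e0; have := h2 e e0; apply: filterS => s; rewrite !ipxx.
Qed.

Lemma opnorm_le (A : {linear H -> H}) (M : R) : (opnorm A <= M%:E)%E ->
  forall h, `|A h| <= M * `|h|.
Proof.
move=> hA h; have [->|h0] := eqVneq h 0; first by rewrite linear0 !normr0 mulr0.
have n0 : 0 < `|h| by rewrite normr_gt0.
rewrite -ler_pdivrMr// -lee_fin; apply: le_trans hA; apply: ereal_sup_ubound.
exists (`|h|^-1 *: h) => /=.
  by rewrite normrZ ger0_norm ?invr_ge0// mulVf// gt_eqF.
by rewrite linearZ /= normrZ ger0_norm ?invr_ge0// mulrC.
Qed.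

(** Mean value inequality on a convex set: apply the scalar one to the inner
    product of F along the segment with the increment of F itself. *)
Lemma cball_lipschitz (F : H -> H) (c : H) (rho M : R) :
  (forall u, cball c rho u -> differentiable F u) ->
  (forall u, cball c rho u -> forall h, `|'d F u h| <= M * `|h|) ->
  forall x z, cball c rho x -> cball c rho z -> `|F x - F z| <= M * `|x - z|.
Proof.
move=> dF bF x z Kx Kz; set w := F x - F z.
have [->|w0] := eqVneq w 0.
  by rewrite normr0; apply: le_trans (bF _ Kx (x - z)).
pose p s := z + s *: (x - z).
pose J : set R := [set` `[0, 1]].
have Kp s : J s -> cball c rho (p s).
  rewrite /J /= in_itv/= => /andP[s0 s1]; move: Kx Kz; rewrite /cball /p /= => Kx Kz.
  have -> : z + s *: (x - z) - c = (1 - s) *: (z - c) + s *: (x - c).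
    by apply: (ip_inj ip_inner) => v; rewrite !ipE; ring.
  apply: le_trans (ler_normD _ _) _; rewrite !normrZ ger0_norm ?subr_ge0//.
  rewrite ger0_norm//; nra.
pose C := M * `|x - z| * `|w|.
have := @tangent_within_nonincreasing R J
  (fun s => ip (F (p s)) w + (0 + s *: (- C : R^o)))
  (fun s => ip ('d F (p s) (x - z)) w + ip (F (p s)) 0 - C) 0 1.
rewrite /J /= !in_itv/= !lexx !ler01 => /(_ (@interval_is_interval R _) isT isT isT).
have e1 : p 1 = x by rewrite /p scale1r addrC subrK.
have e0 : p 0 = z by rewrite /p scale0r addr0.
rewrite e0 e1 scale1r scale0r !add0r addr0 => hM.
have {}hM : ip (F x) w - C <= ip (F z) w.
  apply: hM => s Js.
    apply: tangent_withinD; last exact: tangent_within_affine.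
    apply: tangent_within_ip; last exact: tangent_within_cst.
    apply: tangent_within_comp; first by apply: dF; exact: Kp.
    exact: tangent_within_affine.
  rewrite linear0r addr0 subr_le0; apply: le_trans (Cauchy_Schwarz ip_inner _ _) _.
  by rewrite ler_wpM2r// bF//; exact: Kp.
have : `|w| ^+ 2 <= C by rewrite -ipxx {1}/w linearBl; lra.
by rewrite expr2 /C ler_pM2r// normr_gt0.
Qed.

Section MonotoneDerivative.
Context (F : H -> H) (u : H) (e : R).
Hypothesis F_mono : monotone_op ip F.
Hypothesis dF : differentiable F u.
Hypothesis e0 : 0 < e.

(** Divide the monotonicity inequality between u and u + s h by s^2 and let s
    decrease to 0. *)
Lemma monotone_diff h : 0 <= ip ('d F u h) h.
Proof.
have p0 : u + 0 *: h = u by rewrite scale0r addr0.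
have T : tangent_within setT (fun s => F (u + s *: h)) 0 ('d F u h).
  have := @tangent_within_comp R H H setT F (fun s => u + s *: h) 0 h.
  rewrite p0 => /(_ dF); apply; exact: tangent_within_affine.
suff hd d : 0 < d -> 0 <= ip ('d F u h) h + d * `|h|.
  apply/ler_addgt0Pr => d d0; have p : 0 < d / (1 + `|h|).
    by rewrite divr_gt0// ltr_wpDr.
  apply: le_trans (hd _ p) _; rewrite lerD2l -mulrA ler_piMr ?(ltW d0)//.
  by rewrite mulrC ler_pdivrMr ?ltr_wpDr// mul1r lerDr.
move=> d0; have := T _ d0; rewrite near_withinE => hn.
near (0 : R)^'+ => s.
have s0 : 0 < s by near: s; exact: nbhs_right_gt.
have : `|F (u + s *: h) - F (u + 0 *: h) - (s - 0) *: 'd F u h| <= d * `|s - 0|.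
  near: s; apply: cvg_within; by apply: filterS hn => x; exact.
rewrite p0 !subr0 (gtr0_norm s0) => hs.
have := F_mono (u + s *: h) u.
rewrite [u + _ - u]addrC addKr ipZr pmulr_rge0// => h1.
have := Cauchy_Schwarz ip_inner (F (u + s *: h) - F u - s *: 'd F u h) h.
rewrite linearBl ipZl => h2.
have h3 : `|F (u + s *: h) - F u - s *: 'd F u h| * `|h| <= d * s * `|h|.
  by rewrite ler_wpM2r.
rewrite -(pmulr_rge0 _ s0) mulrDr; move: h1 h2 h3; rewrite !linearBl; lra.
Unshelve. all: by end_near. Qed.

Lemma reg_deriv_coercive h : e * `|h| ^+ 2 <= ip (reg_deriv F e u h) h.
Proof. by rewrite /reg_deriv linearDl ipZl ipxx lerDr monotone_diff. Qed.

Lemma reg_deriv_lower_bound h : e * `|h| <= `|reg_deriv F e u h|.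
Proof.
have [->|h0] := eqVneq h 0; first by rewrite normr0 mulr0.
have n0 : 0 < `|h| by rewrite normr_gt0.
rewrite -(ler_pM2r n0) -mulrA -expr2; apply: le_trans (reg_deriv_coercive h) _.
exact: Cauchy_Schwarz.
Qed.

Lemma reg_deriv_linear : linear (reg_deriv F e u).
Proof.
move=> a x y; rewrite /reg_deriv linearP !scalerDr !scalerA (mulrC e) -!addrA.
by congr (_ + _); rewrite addrCA.
Qed.

Lemma reg_deriv_bijective : bijective (reg_deriv F e u).
Proof.
pose lin := GRing.isLinear.Build R H H _ _ reg_deriv_linear.
pose A : {linear H -> H} := HB.pack (reg_deriv F e u) lin.
apply: (@coercive_linear_bijective _ _ _ ip_inner A e) => //.
  move=> x; rewrite /A /= /reg_deriv; apply: continuousD.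
    exact: diff_continuous.
  exact: scaler_continuous.
exact: reg_deriv_coercive.
Qed.

End MonotoneDerivative.
End MonotoneOperator.

(** * The regularized variational inequality *)

Section RegularizedInequality.
Context (R : realType) (H : completeNormedModType R) (ip : {biscalar H}).
Hypothesis ip_inner : inner_product ip.
Context (F : H -> H).
Hypothesis F_mono : monotone_op ip F.

Let ipC := ipC ip_inner.
Let ipxx := ipxx ip_inner.
Let ipE := ipE ip.

(** The equation F x + e x = g relaxed to a variational inequality on K.  It is
    solvable with the control of F on K only, and keeps the estimates which the
    equation owes to monotonicity. *)
Definition regularized_vi (K : set H) (e : R) (g x : H) : Prop :=
  K x /\ forall v, K v -> 0 <= ip (F x + e *: x - g) (v - x).

Lemma regularized_vi_exists (c : H) (rho M e : R) (g : H) : 0 <= rho -> 0 < e ->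
  (forall x z, cball c rho x -> cball c rho z -> `|F x - F z| <= M * `|x - z|) ->
  exists x, regularized_vi (cball c rho) e g x.
Proof.
move=> rho0 e0 FL.
have dE x z : F x + e *: x - g - (F z + e *: z - g) = F x - F z + e *: (x - z).
  by apply: (ip_inj ip_inner) => v; rewrite !ipE; ring.
have [x z Kx Kz|x z _ _|x Kx hx] := @strongly_monotone_variational_inequality
  _ _ _ ip_inner (cball c rho) (ball_proj c rho) (fun x => F x + e *: x - g)
  e (M + e) (cball_closed (rho := rho)) (ball_projP ip_inner _ rho0) e0.
- rewrite dE; apply: le_trans (ler_normD _ _) _.
  by rewrite normrZ (gtr0_norm e0) mulrDl lerD2r; exact: FL.
- by rewrite dE linearDl ipZl ipxx lerDr F_mono.
by exists x.
Qed.

Lemma solution_regularized_vi K e x : K x -> regularized_vi K e (F x + e *: x) x.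
Proof. by move=> Kx; split=> // v _; rewrite subrr linear0l. Qed.

(** Test the inequality with the point obtained by moving from x against the
    defect of the equation by the distance left to the sphere. *)
Lemma regularized_vi_interior c rho e g x : regularized_vi (cball c rho) e g x ->
  `|x - c| < rho -> F x + e *: x = g.
Proof.
move=> [_ hx] xr; apply/subr0_eq; set z := _ - g.
have [//|z0] := eqVneq z 0.
have n0 : 0 < `|z| by rewrite normr_gt0.
pose s := (rho - `|x - c|) / `|z|.
have s0 : 0 < s by rewrite divr_gt0// subr_gt0.
have := hx (x - s *: z); rewrite -/z addrAC subrr add0r linearNr oppr_ge0 ipZr.
rewrite pmulr_rle0// ipxx => h; apply/eqP.
rewrite -normr_eq0 -sqrf_eq0 eq_le sqr_ge0 h//.
rewrite /cball /= addrAC; apply: le_trans (ler_normB _ _) _.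
by rewrite normrZ gtr0_norm// divfK ?gt_eqF// subrKC.
Qed.

(** Lipschitz dependence of the resolvent on both of its parameters: test each
    inequality with the solution of the other and add. *)
Lemma regularized_vi_dist K e e' g g' x x' : 0 < e ->
  regularized_vi K e g x -> regularized_vi K e' g' x' ->
  e * `|x - x'| <= `|g - g'| + `|e - e'| * `|x'|.
Proof.
move=> e0 [Kx hx] [Kx' hx'].
have [->|n0] := eqVneq x x'.
  by rewrite subrr normr0 mulr0 addr_ge0// mulr_ge0.
have p : 0 < `|x - x'| by rewrite normr_gt0 subr_eq0.
rewrite -(ler_pM2r p) -mulrA -expr2 -ipxx.
have h : e * ip (x - x') (x - x') <= ip ((g - g') - (e - e') *: x') (x - x').
  have := F_mono x x'; have := hx _ Kx'; have := hx' _ Kx.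
  rewrite !ipE; lra.
apply: le_trans h (le_trans (Cauchy_Schwarz ip_inner _ _) _).
by rewrite ler_wpM2r// (le_trans (ler_normB _ _))// normrZ.
Qed.

(** A zero y of F is a competitor, and monotonicity makes the angle at x between
    the origin and y obtuse; the inequality is that of an obtuse triangle. *)
Lemma regularized_vi_zero K e x y : 0 < e -> regularized_vi K e 0 x ->
  K y -> F y = 0 -> `|x - y| ^+ 2 <= `|y| ^+ 2 - `|x| ^+ 2.
Proof.
move=> e0 [_ hx] Ky Fy.
have : 0 <= e * ip x (y - x).
  have := hx _ Ky; have := F_mono x y; rewrite Fy !ipE; lra.
rewrite pmulr_rge0// (normB2 ip_inner) linearBr ipxx; lra.
Qed.

(** Norms of the regularized solutions increase when e decreases, and their
    increase controls the distance: this replaces weak compactness in the proof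
    of convergence. *)
Lemma regularized_vi_monotone K e e' x x' : 0 < e -> e <= e' ->
  regularized_vi K e 0 x -> regularized_vi K e' 0 x' ->
  `|x - x'| ^+ 2 <= `|x| ^+ 2 - `|x'| ^+ 2.
Proof.
move=> e0 ee hx hx'.
have [e_eq|en] := eqVneq e e'.
  have := regularized_vi_dist e0 hx hx'; rewrite e_eq !subrr !normr0 mul0r addr0.
  rewrite -e_eq pmulr_rle0// normr_le0 subr_eq0 => /eqP ->.
  by rewrite !subrr normr0 expr0n.
have {en}ee : 0 < e' - e by rewrite subr_gt0 lt_def eq_sym en.
have : e * ip (x - x') (x - x') <= (e' - e) * ip x' (x - x').
  have := F_mono x x'; have := hx.2 _ hx'.1; have := hx'.2 _ hx.1.
  rewrite !ipE; lra.
rewrite ipxx => h.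
have : 0 <= (e' - e) * ip x' (x - x').
  by apply: le_trans h; rewrite mulr_ge0 ?sqr_ge0// ltW.
by rewrite pmulr_rge0// (normB2 ip_inner) linearBr ipxx (ipC x'); lra.
Qed.

(** The squared norms are monotone and bounded, hence so close to their supremum
    that the w t form a Cauchy family.  Their limit is a zero of F, and passing to
    the limit in the obtuse triangle inequality compares it with y. *)
Lemma regularized_vi_cvg (K : set H) (y : H) (e : R -> R) (w : R -> H) :
  closed K -> K y -> F y = 0 -> (forall z, F z = 0 -> `|y| <= `|z|) ->
  (forall x, K x -> {for x, continuous F}) ->
  (forall t, 0 <= t -> 0 < e t) ->
  (forall s t, 0 <= s -> s <= t -> e t <= e s) ->
  e t @[t --> +oo] --> 0 ->
  (forall t, 0 <= t -> regularized_vi K (e t) 0 (w t)) ->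
  (exists2 T, 0 <= T & forall t, T <= t -> F (w t) + e t *: w t = 0) ->
  w t @[t --> +oo] --> y.
Proof.
move=> Kcl Ky Fy ymin Fc e0 e_dec e_cvg hw [T0 T00 Fw].
have wy t : 0 <= t -> `|w t - y| ^+ 2 <= `|y| ^+ 2 - `|w t| ^+ 2.
  by move=> t0; apply: regularized_vi_zero (e0 _ t0) (hw _ t0) Ky Fy.
have wn t : 0 <= t -> `|w t| <= `|y|.
  move=> t0; rewrite -ler_sqr ?nnegrE// -subr_ge0.
  by apply: le_trans (wy _ t0); exact: sqr_ge0.
have w_mono s t : 0 <= s -> s <= t -> `|w t - w s| ^+ 2 <= `|w t| ^+ 2 - `|w s| ^+ 2.
  move=> s0 st; have t0 := le_trans s0 st.
  exact: regularized_vi_monotone (e0 _ t0) (e_dec _ _ s0 st) (hw _ t0) (hw _ s0).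
pose A := [set `|w t| ^+ 2 | t in [set t : R | 0 <= t]].
have hA : has_sup A.
  split; first by exists (`|w 0| ^+ 2), 0 => //=.
  by exists (`|y| ^+ 2) => _ [t t0 <-]; rewrite ler_sqr ?nnegrE//; exact: wn.
have cw : cvg (w t @[t --> +oo]).
  apply/cauchy_cvgP/cauchy_exP => d d0.
  have d20 : 0 < d ^+ 2 by rewrite exprn_gt0.
  have [_ [T T_ge0 <-] hT] := sup_adherent d20 hA.
  exists (w T); exists T; split; first exact: num_real.
  move=> t Tt; rewrite /= -ball_normE /ball_ /= distrC.
  rewrite -ltr_sqr ?nnegrE ?(ltW d0)//.
  apply: le_lt_trans (w_mono _ _ T_ge0 (ltW Tt)) _.
  have : `|w t| ^+ 2 <= sup A.
    by apply: ub_le_sup => //; [exact: hA.2|exists t => //=; exact: le_trans (ltW Tt)].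
  by move: hT; lra.
have /cvg_ex[l hl] := cw.
have Kl : K l.
  apply: (@closed_cvg _ _ _ _ w K Kcl _ l hl); near=> t.
  have t0 : 0 <= t by near: t; exact: nbhs_pinfty_ge.
  exact: (hw _ t0).1.
have Fl : F l = 0.
  have h1 : F (w t) @[t --> +oo] --> F l by apply: continuous_cvg hl; exact: Fc.
  have h2 : F (w t) @[t --> +oo] --> (0 : H).
    have : - (e t *: w t) @[t --> +oo] --> - (0 *: l).
      by apply: cvgN; apply: cvgZ.
    rewrite scale0r oppr0; apply: cvg_trans; apply: near_eq_cvg.
    near=> t; have t0 : T0 <= t.
      by near: t; apply: nbhs_pinfty_ge; exact: num_real.
    by apply/eqP; rewrite eq_sym -addr_eq0 Fw.
  exact: cvg_unique h1 h2.
have cvg_sqr (z : R -> R) (a : R) : z t @[t --> +oo] --> a ->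
    z t ^+ 2 @[t --> +oo] --> a ^+ 2.
  by move=> h; exact: (cvgM h h).
have lly : `|l - y| ^+ 2 <= `|y| ^+ 2 - `|l| ^+ 2.
  have h1 : `|w t - y| ^+ 2 @[t --> +oo] --> `|l - y| ^+ 2.
    by apply: cvg_sqr; apply: cvg_norm; exact: (cvgB hl (cvg_cst y)).
  have h2 : `|y| ^+ 2 - `|w t| ^+ 2 @[t --> +oo] --> `|y| ^+ 2 - `|l| ^+ 2.
    by apply: cvgB; [exact: cvg_cst|apply: cvg_sqr; apply: cvg_norm hl].
  apply: ler_cvg_to h1 h2 _; near=> t; apply: wy; near: t; exact: nbhs_pinfty_ge.
suff <- : l = y by [].
apply/subr0_eq/normr0_eq0/eqP; rewrite -sqrf_eq0 eq_le sqr_ge0 andbT.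
apply: le_trans lly _; rewrite subr_le0 ler_sqr ?nnegrE//; exact: ymin.
Unshelve. all: by end_near. Qed.

End RegularizedInequality.

(** * Differential inequalities for the residual *)

Section HarmonicDecay.
Context (R : realType).

(** The shape of the regularization parameter eps = c1 / (5 + t).  The offset 5
    gives |eps'| / eps <= 1 / 5 at all times, which is the smallness required by
    the differential inequalities. *)
Definition harmonic5 (t : R) : R := (5 + t)^-1.

Let a := harmonic5.

Lemma harmonic5_gt0 t : 0 <= t -> 0 < a t.
Proof. by move=> t0; rewrite invr_gt0 ltr_wpDr. Qed.

Lemma harmonic5_le t : 0 <= t -> a t <= 1 / 5.
Proof.
by move=> t0; rewrite div1r lef_pV2 ?posrE ?ltr_wpDr// lerDl.
Qed.

Lemma harmonic5B s t : 0 <= s -> 0 <= t -> a s - a t = - (s - t) * (a s * a t).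
Proof.
move=> s0 t0; rewrite /a /harmonic5; field.
by rewrite !gt_eqF// ltr_wpDr.
Qed.

Lemma harmonic5_lipschitz s t : 0 <= s -> 0 <= t -> `|a s - a t| <= `|s - t|.
Proof.
move=> s0 t0; rewrite harmonic5B// normrM normrN ler_piMr//.
have := harmonic5_gt0 s0; have := harmonic5_gt0 t0.
have := harmonic5_le s0; have := harmonic5_le t0 => h1 h2 h3 h4.
rewrite ger0_norm; nra.
Qed.

Lemma harmonic5_sqr_lipschitz s t : 0 <= s -> 0 <= t ->
  `|a s ^+ 2 - a t ^+ 2| <= `|s - t|.
Proof.
move=> s0 t0; rewrite subr_sqr normrM.
have := harmonic5_lipschitz s0 t0.
have := harmonic5_gt0 s0; have := harmonic5_gt0 t0.
have := harmonic5_le s0; have := harmonic5_le t0 => h1 h2 h3 h4 h5.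
have : `|a s + a t| <= 1 by rewrite ger0_norm; lra.
have := normr_ge0 (a s + a t); have := normr_ge0 (a s - a t); nra.
Qed.

Lemma harmonic5_tangent J t : J `<=` `[0, +oo[ -> J t ->
  tangent_within J a t (- a t ^+ 2 : R^o).
Proof.
move=> J0 Jt; apply: (quadratic_tangent (C := 1)).
rewrite near_withinE; apply: nearW => s Js.
have := J0 _ Jt; rewrite /= in_itv/= andbT => t0.
have := J0 _ Js; rewrite /= in_itv/= andbT => s0.
have -> : a s - a t - (s - t) *: (- a t ^+ 2 : R^o) = (s - t) ^+ 2 * (a t ^+ 2 * a s).
  transitivity (a s - a t - (s - t) * (- a t ^+ 2)) => //.
  rewrite /a /harmonic5; field.
  by rewrite !gt_eqF// ltr_wpDr.
have := harmonic5_gt0 s0; have := harmonic5_gt0 t0.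
have := harmonic5_le s0; have := harmonic5_le t0 => h1 h2 h3 h4.
have p : 0 <= a t ^+ 2 * a s <= 1.
  have : a t ^+ 2 <= 1 by nra.
  have : 0 <= a t ^+ 2 by nra.
  by move=> h5 h6; apply/andP; split; nra.
rewrite normrM normrX mul1r ler_piMr ?sqr_ge0//.
by case/andP: p => p1 p2; rewrite ger0_norm.
Qed.

Lemma harmonic5_cvg0 : a t @[t --> +oo] --> 0.
Proof.
apply/cvgrPdist_le => e e0; near=> t.
have t0 : 0 <= t by near: t; exact: nbhs_pinfty_ge.
have te : e^-1 <= t by near: t; apply: nbhs_pinfty_ge; exact: num_real.
rewrite sub0r normrN gtr0_norm ?harmonic5_gt0// /a /harmonic5.
rewrite -[e]invrK lef_pV2 ?posrE ?invr_gt0 ?ltr_wpDr//; lra.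
Unshelve. all: by end_near. Qed.

Lemma harmonic5_anti s t : 0 <= s -> s <= t -> a t <= a s.
Proof.
move=> s0 st; rewrite /a /harmonic5 lef_pV2 ?posrE ?lerD2l// ltr_wpDr//.
exact: le_trans st.
Qed.

Lemma eps_fun_harmonic5 c1 t : 0 <= t -> eps_fun 5 c1 1 t = c1 * a t.
Proof. by move=> t0; rewrite /eps_fun powR_inv1// addr_ge0. Qed.

End HarmonicDecay.

Section ResidualEstimates.
Context (R : realType) (H : completeNormedModType R) (ip : {biscalar H}).
Hypothesis ip_inner : inner_product ip.
Variable c1 : R.
Hypothesis c10 : 0 < c1.
Variable J : set R.
Hypotheses (Ji : is_interval J) (J_ge0 : J `<=` `[0, +oo[) (J0 : J 0).

Let a : R -> R := @harmonic5 R.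
Let ipC := ipC ip_inner.
Let ipxx := ipxx ip_inner.
Let ipE := ipE ip.

Let Jge0 t : J t -> 0 <= t.
Proof. by move=> /J_ge0; rewrite /= in_itv/= andbT. Qed.

(** The damping term -(g1 - g2) dominates the coupling through u1 - u2, which is
    at most |eps'| / eps <= 1 / 5 times |g1 - g2|; what is left over absorbs the
    forcing p1 - p2 by Young's inequality. *)
Lemma residual_difference (g1 g2 u1 u2 : R -> H) (p1 p2 : H) :
  (forall t, J t -> tangent_within J g1 t
     (- (g1 t - p1) - (c1 * a t ^+ 2) *: u1 t)) ->
  (forall t, J t -> tangent_within J g2 t
     (- (g2 t - p2) - (c1 * a t ^+ 2) *: u2 t)) ->
  (forall t, J t -> c1 * a t * `|u1 t - u2 t| <= `|g1 t - g2 t|) ->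
  g1 0 = g2 0 ->
  forall t, J t -> `|g1 t - g2 t| ^+ 2 <= `|p1 - p2| ^+ 2 * t.
Proof.
move=> T1 T2 hu g0 t Jt.
pose D s := g1 s - g2 s.
pose D' s := - (g1 s - p1) - (c1 * a s ^+ 2) *: u1 s -
  (- (g2 s - p2) - (c1 * a s ^+ 2) *: u2 s).
pose k := `|p1 - p2| ^+ 2.
have := @tangent_within_nonincreasing R J (fun s => `|D s| ^+ 2 + (0 + s *: (- k : R^o)))
  (fun s => 2 * ip (D s) (D' s) - k) 0 t Ji J0 Jt (Jge0 Jt).
have D0 : D 0 = 0 by rewrite /D g0 subrr.
have E : t *: (- k : R^o) = - (k * t) by rewrite /GRing.scale /= mulrN mulrC.
rewrite D0 scale0r normr0 expr0n /= E !addr0 !add0r subr_le0; apply.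
  move=> s Js; apply: tangent_withinD; last exact: tangent_within_affine.
  apply: tangent_within_norm2 => //; apply: tangent_withinD; first exact: T1.
  by apply: tangent_withinN; exact: T2.
move=> s Js; have s0 := Jge0 Js.
have -> : D' s = (p1 - p2) - D s - (c1 * a s ^+ 2) *: (u1 s - u2 s).
  by apply: (ip_inj ip_inner) => v; rewrite /D' /D !ipE; ring.
have h4 := hu _ Js; rewrite -[g1 s - g2 s]/(D s) in h4.
move: (D s) h4 => d h4.
rewrite !(linearBr ip) ipZr ipxx !(linearBr ip).
have h1 := Cauchy_Schwarz ip_inner d (p1 - p2); rewrite linearBr in h1.
have h2 := Cauchy_Schwarz_abs ip_inner d (u1 s - u2 s).
rewrite linearBr ler_norml in h2; have /andP[h3 _] := h2.
have a0 := harmonic5_gt0 s0; have a1 := harmonic5_le s0.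
rewrite -/a in a0 a1.
have h5 : (c1 * a s ^+ 2) * (`|d| * `|u1 s - u2 s|) <= 1 / 5 * `|d| ^+ 2.
  have -> : c1 * a s ^+ 2 * (`|d| * `|u1 s - u2 s|) =
     a s * `|d| * (c1 * a s * `|u1 s - u2 s|) by ring.
  apply: (@le_trans _ _ (a s * `|d| * `|d|)).
    by rewrite ler_wpM2l// mulr_ge0// ltW.
  by rewrite expr2 mulrA ler_wpM2r// ler_wpM2r.
have h6 : (c1 * a s ^+ 2) * (- (`|d| * `|u1 s - u2 s|)) <=
    (c1 * a s ^+ 2) * (ip d (u1 s) - ip d (u2 s)).
  by rewrite ler_wpM2l// mulr_ge0 ?sqr_ge0// ltW.
rewrite /k; have := sqr_ge0 `|d|; have := sqr_ge0 (`|d| - `|p1 - p2|).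
move: h1 h5 h6; nra.
Qed.

(** For phi = |g|^2 / eps^2 the equation gives
    phi' <= - phi + Y^2 / (5 + t), and C / (5 + t) is a supersolution of this
    inequality.  Hence e^t (phi - C / (5 + t)) does not increase. *)
Lemma residual_decay (g u : R -> H) (Y C : R) : 0 <= Y -> 5 / 4 * Y ^+ 2 <= C ->
  (forall t, J t -> tangent_within J g t (- g t - (c1 * a t ^+ 2) *: u t)) ->
  (forall t, J t -> c1 * a t * `|u t| <= c1 * a t * Y + `|g t|) ->
  `|g 0| ^+ 2 <= (c1 * a 0) ^+ 2 * (C * a 0) ->
  forall t, J t -> `|g t| ^+ 2 <= (c1 * a t) ^+ 2 * (C * a t).
Proof.
move=> Y0 YC T hu g0 t Jt.
(* Psi is c1 ^+ 2 * e^t * (phi - C / (5 + t)), with the factors (5 + t) kept as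
   scalings so that the product rule applies as it stands. *)
pose q s : R := 5 + s *: (1 : R^o); pose k : R^o := - (c1 ^+ 2 * C).
pose g' s := - g s - (c1 * a s ^+ 2) *: u s.
have qE s : q s = 5 + s by rewrite /q [_ *: _]mulr1.
have qa s : J s -> q s * a s = 1.
  by move=> /Jge0 s0; rewrite qE /a /harmonic5 mulfV// gt_eqF// ltr_wpDr.
pose Psi s : R^o := expR s *: (q s *: (q s *: (`|g s| ^+ 2 : R^o)) + a s *: k).
pose Psi' s : R^o := expR s *: (q s *: (q s *: (`|g s| ^+ 2 : R^o)) + a s *: k) +
  expR s *: (((1 : R) *: (q s *: (`|g s| ^+ 2 : R^o)) +
    q s *: ((1 : R) *: (`|g s| ^+ 2 : R^o) + q s *: (2 * ip (g s) (g' s) : R^o))) +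
   ((- a s ^+ 2 : R) *: k + a s *: (0 : R^o))).
have PT s : J s -> tangent_within J Psi s (Psi' s).
  move=> Js; have qT : tangent_within J q s (1 : R^o) by exact: tangent_within_affine.
  apply: tangent_withinZ; first exact: derive_tangent_within.
  apply: tangent_withinD.
    apply: tangent_withinZ => //; apply: tangent_withinZ => //.
    by apply: tangent_within_norm2 => //; exact: T.
  by apply: tangent_withinZ; [exact: harmonic5_tangent | exact: tangent_within_cst].
have Psi'0 s : J s -> Psi' s <= 0.
  move=> Js; have s0 := Jge0 Js.
  have -> : Psi' s = expR s * (q s ^+ 2 * `|g s| ^+ 2 + 2 * q s * `|g s| ^+ 2 +
      q s ^+ 2 * (2 * ip (g s) (g' s)) - c1 ^+ 2 * C * (a s - a s ^+ 2)).
    by rewrite /Psi' /k /GRing.scale /=; ring.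
  rewrite pmulr_rle0 ?expR_gt0//.
  have a0 := harmonic5_gt0 s0; have a1 := harmonic5_le s0.
  have := qa _ Js; have := qE s; rewrite -/a in a0 a1 *.
  have := hu _ Js; have := Cauchy_Schwarz_abs ip_inner (g s) (u s).
  rewrite ler_norml => /andP[h1 _].
  rewrite /g' !ipE ipxx.
  move: (q s) (a s) a0 a1 h1 => Q A A0 A1 h1 h2 hQ QA.
  have Q5 : 5 <= Q by rewrite hQ lerDl.
  set G := `|g s| in h1 h2 *; have G0 : 0 <= G by exact: normr_ge0.
  have e1 : Q ^+ 2 * A ^+ 2 = 1 by rewrite -exprMn QA expr1n.
  have -> : Q ^+ 2 * (2 * (- G ^+ 2 - c1 * A ^+ 2 * ip (g s) (u s))) =
     - 2 * Q ^+ 2 * G ^+ 2 + 2 * c1 * (- ip (g s) (u s)).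
    have -> : 2 * c1 * - ip (g s) (u s) = 2 * c1 * - ip (g s) (u s) * (Q ^+ 2 * A ^+ 2).
      by rewrite e1 mulr1.
    by ring.
  have h3 : c1 * (- ip (g s) (u s)) <= G * (c1 * Y + Q * G).
    apply: (@le_trans _ _ (G * (Q * (c1 * A * `|u s|)))).
      have -> : G * (Q * (c1 * A * `|u s|)) = c1 * (G * `|u s|) * (Q * A) by ring.
      by rewrite QA mulr1 ler_pM2l//; lra.
    rewrite ler_wpM2l//.
    have -> : c1 * Y + Q * G = Q * (c1 * A * Y + G).
      have -> : Q * (c1 * A * Y + G) = c1 * Y * (Q * A) + Q * G by ring.
      by rewrite QA mulr1.
    by rewrite ler_wpM2l//; lra.
  (* Young's inequality, weighted so that the term in G is absorbed by Q >= 5. *)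
  have h4 : 2 * (G * c1 * Y) <= c1 ^+ 2 * A * Y ^+ 2 + Q * G ^+ 2.
    have := mulr_ge0 (ltW A0) (sqr_ge0 (c1 * Y - Q * G)).
    have -> : A * (c1 * Y - Q * G) ^+ 2 =
      c1 ^+ 2 * A * Y ^+ 2 - 2 * (G * c1 * Y) * (Q * A) + Q * G ^+ 2 * (Q * A) by ring.
    by rewrite QA !mulr1; lra.
  have h5 : Q * G ^+ 2 * (5 - Q) <= 0.
    by rewrite mulr_ge0_le0 ?subr_le0// mulr_ge0 ?sqr_ge0//; lra.
  have h6 : c1 ^+ 2 * A * (Y ^+ 2 - C * (1 - A)) <= 0.
    rewrite mulr_ge0_le0//; first by rewrite mulr_ge0 ?sqr_ge0// ltW.
    have := sqr_ge0 Y; nra.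
  lra.
have := tangent_within_nonincreasing Ji J0 Jt (Jge0 Jt) PT Psi'0.
have Psi0 : Psi 0 <= 0.
  rewrite /Psi expR0 scale1r; have q0 := qa _ J0.
  have -> : (q 0 *: (q 0 *: (`|g 0| ^+ 2 : R^o)) + a 0 *: k : R) =
     q 0 ^+ 2 * `|g 0| ^+ 2 - c1 ^+ 2 * (C * a 0).
    by rewrite /k /GRing.scale /=; ring.
  rewrite subr_le0; apply: (@le_trans _ _ (q 0 ^+ 2 * ((c1 * a 0) ^+ 2 * (C * a 0)))).
    by rewrite ler_wpM2l ?sqr_ge0.
  have -> : q 0 ^+ 2 * ((c1 * a 0) ^+ 2 * (C * a 0)) =
    c1 ^+ 2 * (C * a 0) * (q 0 * a 0) ^+ 2 by ring.
  by rewrite q0 expr1n mulr1.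
move=> /le_trans/(_ Psi0); rewrite /Psi.
have -> : (expR t *: (q t *: (q t *: (`|g t| ^+ 2 : R^o)) + a t *: k) : R) =
     expR t * (q t ^+ 2 * `|g t| ^+ 2 - c1 ^+ 2 * (C * a t)).
  by rewrite /k /GRing.scale /=; ring.
rewrite pmulr_rle0 ?expR_gt0// subr_le0 => h.
have : a t ^+ 2 * (q t ^+ 2 * `|g t| ^+ 2) <= a t ^+ 2 * (c1 ^+ 2 * (C * a t)).
  by rewrite ler_wpM2l ?sqr_ge0.
have -> : a t ^+ 2 * (q t ^+ 2 * `|g t| ^+ 2) = (q t * a t) ^+ 2 * `|g t| ^+ 2 by ring.
by rewrite qa// expr1n mul1r [(c1 * _) ^+ 2]exprMn mulrCA mulrA.
Qed.

End ResidualEstimates.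

(** * The residual flow and the Newton equation *)

Section NewtonFlow.
Context (R : realType) (H : completeNormedModType R) (ip : {biscalar H}).
Hypothesis ip_inner : inner_product ip.
Context (F : H -> H) (c : H) (rho M c1 : R).
Hypothesis F_mono : monotone_op ip F.
Hypothesis rho_ge0 : 0 <= rho.
Hypothesis c1_gt0 : 0 < c1.
Hypothesis F_diff : forall u, cball c rho u -> differentiable F u.
Hypothesis F_bound :
  forall u, cball c rho u -> forall h, `|'d F u h| <= M * `|h|.

Let ipE := ipE ip.
Let K := cball c rho.
Let a : R -> R := @harmonic5 R.
Let eps t := c1 * a t.

Let eps_gt0 t : 0 <= t -> 0 < eps t.
Proof. by move=> t0; rewrite mulr_gt0// harmonic5_gt0. Qed.

Let eps_lipschitz s t : 0 <= s -> 0 <= t -> `|eps s - eps t| <= c1 * `|s - t|.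
Proof.
move=> s0 t0; rewrite -mulrBr normrM gtr0_norm// ler_pM2l//.
exact: harmonic5_lipschitz.
Qed.

Let K_bounded x : K x -> `|x| <= `|c| + rho.
Proof.
rewrite /K /cball /= => Kx; rewrite -[x](subrKC c).
by apply: le_trans (ler_normD _ _) _; rewrite lerD2l.
Qed.

Let B_ge0 : 0 <= `|c| + rho.
Proof. by rewrite addr_ge0. Qed.

Lemma pinv_bij (A : H -> H) z : bijective A -> A (pinv setT A z) = z.
Proof. by move=> [A' _ AA']; rewrite pinvK// inE; exists (A' z). Qed.

(** The unknown is the residual: u is recovered from g by the resolvent, which
    is Lipschitz, so the field is globally Lipschitz although F' may vary and
    F may be uncontrolled outside K. *)
Lemma residual_flow (p g0 : H) : exists g u : R -> H, g 0 = g0 /\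
  forall t, 0 <= t ->
    regularized_vi ip F K (eps t) (g t) (u t) /\
    tangent_within `[0, +oo[ g t (- (g t - p) - (c1 * a t ^+ 2) *: u t).
Proof.
have hex (z : R * H) : exists x : H, 0 < z.1 -> regularized_vi ip F K z.1 z.2 x.
  have [z0|z0] := boolP (0 < z.1); last by exists 0.
  have [x hx] := regularized_vi_exists ip_inner F_mono z.2 rho_ge0 z0
    (cball_lipschitz ip_inner F_diff F_bound).
  by exists x.
have [res hres] := choice hex.
pose G t g := - (g - p) - (c1 * a t ^+ 2) *: res (eps t, g).
pose L := 2 + 2 * (c1 * (`|c| + rho)).
have L0 : 0 < L by rewrite ltr_wpDr// mulr_ge0// mulr_ge0// ltW.
have GL s t x z : 0 <= s -> 0 <= t ->
    `|G s x - G t z| <= L * (`|s - t| + `|x - z|).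
  move=> s0 t0; set r1 := res (eps s, x); set r2 := res (eps t, z).
  have -> : G s x - G t z = - (x - z) - (c1 * a s ^+ 2) *: (r1 - r2)
      - (c1 * (a s ^+ 2 - a t ^+ 2)) *: r2.
    rewrite /G -/r1 -/r2; move: r1 r2 (a s ^+ 2) (a t ^+ 2) => r1 r2 a1 a2.
    by apply: (ip_inj ip_inner) => v; rewrite !ipE; ring.
  have h1 := hres (eps s, x) (eps_gt0 s0).
  have h2 := hres (eps t, z) (eps_gt0 t0).
  have h3 := regularized_vi_dist ip_inner F_mono (eps_gt0 s0) h1 h2.
  have h4 := K_bounded h2.1; rewrite -/r1 -/r2 /= in h3 h4.
  have h5 : `|eps s - eps t| * `|r2| <= c1 * `|s - t| * (`|c| + rho).
    by rewrite ler_pM// eps_lipschitz.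
  have h6 : `|(c1 * (a s ^+ 2 - a t ^+ 2)) *: r2| <= c1 * `|s - t| * (`|c| + rho).
    rewrite normrZ normrM (gtr0_norm c1_gt0) ler_pM// ?ler_pM2l//.
      by rewrite mulr_ge0// ltW.
    exact: harmonic5_sqr_lipschitz.
  have h7 : `|(c1 * a s ^+ 2) *: (r1 - r2)| <=
      `|x - z| + c1 * `|s - t| * (`|c| + rho).
    have a0 := harmonic5_gt0 s0; have a1 := harmonic5_le s0.
    rewrite normrZ ger0_norm; last by rewrite mulr_ge0 ?sqr_ge0// ltW.
    have -> : c1 * a s ^+ 2 * `|r1 - r2| = a s * (eps s * `|r1 - r2|).
      by rewrite /eps; ring.
    apply: (@le_trans _ _ (eps s * `|r1 - r2|)); last first.
      by apply: le_trans h3 _; rewrite lerD2l.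
    rewrite ler_piMl//; last by apply: le_trans a1 _; lra.
    by rewrite mulr_ge0// ltW// eps_gt0.
  apply: le_trans (ler_normB _ _) _.
  apply: le_trans (lerD (ler_normB _ _) (lexx _)) _; rewrite normrN /L.
  have q1 : 0 <= c1 * (`|c| + rho) * `|x - z| by rewrite !mulr_ge0// ltW.
  have := normr_ge0 (s - t); move: h6 h7; lra.
have [g [g00 hg]] := lipschitz_ode_solution g0 L0 GL.
exists g, (fun t => res (eps t, g t)); split=> // t t0; split.
  exact: (hres (eps t, g t) (eps_gt0 t0)).
exact: hg.
Qed.

Section OnInterval.
Variable J : set R.
Hypothesis J_ge0 : J `<=` `[0, +oo[.

Let Jge0 t : J t -> 0 <= t.
Proof. by move=> /J_ge0; rewrite /= in_itv/= andbT. Qed.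

Let eps_tangent t : J t -> tangent_within J eps t (- (c1 * a t ^+ 2) : R^o).
Proof.
move=> Jt.
have := tangent_withinZ (tangent_within_cst J t (c1 : R^o)) (harmonic5_tangent J_ge0 Jt).
have -> // : (0 : R) *: (harmonic5 t : R^o) + c1 *: (- harmonic5 t ^+ 2 : R^o) =
   - (c1 * a t ^+ 2) by rewrite scale0r add0r /GRing.scale /= mulrN.
Qed.

(** Along a Newton solution the inverse of F' + eps I cancels against the
    derivative of F(u) + eps u. *)
Lemma residual_of_newton (u : R -> H) (t : R) (v z : H) : J t ->
  differentiable F (u t) -> tangent_within J u t v ->
  reg_deriv F (eps t) (u t) v = - z ->
  tangent_within J (fun s => F (u s) + eps s *: u s) t
    (- z - (c1 * a t ^+ 2) *: u t).
Proof.
move=> Jt dF Tu <-.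
have -> : reg_deriv F (eps t) (u t) v - (c1 * a t ^+ 2) *: u t =
    'd F (u t) v + ((- (c1 * a t ^+ 2)) *: u t + eps t *: v).
  by apply: (ip_inj ip_inner) => h; rewrite /reg_deriv !ipE; ring.
apply: tangent_withinD; first exact: tangent_within_comp.
by apply: tangent_withinZ => //; exact: eps_tangent.
Qed.

(** Differentiation of the implicit equation F(u) + eps u = g.  The curve u is
    Lipschitz because the resolvent is; coercivity of F' + eps I then turns the
    linearized equation into a bound on the remainder of u. *)
Lemma newton_of_residual (g u : R -> H) (t : R) (z : H) :
  (forall s, J s -> regularized_vi ip F K (eps s) (g s) (u s)) ->
  (forall s, J s -> `|u s - c| < rho) ->
  J t -> tangent_within J g t (- z - (c1 * a t ^+ 2) *: u t) ->
  tangent_within J u t (- pinv setT (reg_deriv F (eps t) (u t)) z).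
Proof.
move=> hu hin Jt Tg; have t0 := Jge0 Jt; have e0 := eps_gt0 t0.
have dF : differentiable F (u t) by apply: F_diff; exact: (hu _ Jt).1.
have bij := reg_deriv_bijective ip_inner F_mono dF e0.
set v := - _; pose A := reg_deriv F (eps t) (u t).
have Av : A v = - z.
  have AN x : A (- x) = - A x by rewrite /A /reg_deriv linearN scalerN opprD.
  by rewrite /v AN pinv_bij.
have AB x w : A (x - w) = A x - A w.
  by rewrite /A /reg_deriv linearB scalerBr opprD addrACA.
have AZ k x : A (k *: x) = k *: A x.
  by rewrite /A /reg_deriv linearZ scalerDr !scalerA (mulrC k).
have gE s : J s -> g s = F (u s) + eps s *: u s.
  by move=> Js; rewrite (regularized_vi_interior ip_inner (hu _ Js) (hin _ Js)).
have [C C0 uL] : exists2 C, 0 < C &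
    \forall s \near within J (nbhs t), `|u s - u t| <= C * `|s - t|.
  set g' := (- z - _) in Tg.
  exists ((1 + `|g'| + c1 * (`|c| + rho)) / eps t).
    by rewrite divr_gt0// ltr_wpDr ?mulr_ge0 ?(ltW c1_gt0)// ltr_wpDr.
  have Lg := tangent_within_lipschitz Tg.
  have Jn : \forall s \near within J (nbhs t), J s by rewrite near_withinE; apply: nearW.
  apply: filterS2 Lg Jn => s h1 Js.
  rewrite mulrAC ler_pdivlMr// mulrC distrC.
  apply: le_trans (regularized_vi_dist ip_inner F_mono e0 (hu _ Jt) (hu _ Js)) _.
  rewrite mulrDl lerD ?[`|g t - g s|]distrC//.
  rewrite mulrAC ler_pM// ?K_bounded//; first by rewrite distrC eps_lipschitz// Jge0.
  exact: (hu _ Js).1.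
move=> d d0.
pose k := d * eps t; have k0 : 0 < k by rewrite mulr_gt0.
(* W adds up the weights of the four remainders which are estimated below. *)
pose W := C + 1 + `|u t| + c1 * C.
have W0 : 0 < W.
  by have := mulr_gt0 c1_gt0 C0; have := normr_ge0 (u t); rewrite /W; lra.
have kW0 : 0 < k / W by rewrite divr_gt0.
have cu : u s @[s --> within J (nbhs t)] --> u t.
  apply/cvgrPdist_le => r r0.
  have hd : \forall s \near within J (nbhs t), `|s - t| <= r / C.
    by apply: cvg_within; apply: (near_dist_le (V := R^o)); rewrite divr_gt0.
  apply: filterS2 uL hd => s h1; rewrite ler_pdivlMr// mulrC => h2.
  by rewrite distrC; exact: le_trans h1 h2.
have n1 : \forall s \near within J (nbhs t),
    `|F (u s) - F (u t) - 'd F (u t) (u s - u t)| <= k / W * `|u s - u t|.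
  exact: cu (differentiable_remainder dF kW0).
have n2 := Tg _ kW0.
have n3 := eps_tangent Jt kW0.
have n4 : \forall s \near within J (nbhs t), `|s - t| <= k / W.
  by apply: cvg_within; apply: (near_dist_le (V := R^o)).
near=> s.
have Js : J s by near: s; rewrite near_withinE; apply: nearW.
have h0 : `|u s - u t| <= C * `|s - t| by near: s.
have h1 : `|F (u s) - F (u t) - 'd F (u t) (u s - u t)| <= k / W * `|u s - u t|.
  by near: s.
have h2 : `|g s - g t - (s - t) *: (- z - (c1 * a t ^+ 2) *: u t)| <=
    k / W * `|s - t| by near: s.
have h3 : `|eps s - eps t - (s - t) * (- (c1 * a t ^+ 2))| <= k / W * `|s - t|.
  by near: s.
have h4 : `|s - t| <= k / W by near: s.
rewrite -(ler_pM2l e0).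
apply: le_trans (reg_deriv_lower_bound ip_inner (eps t) F_mono dF _) _.
rewrite -/A AB AB AZ Av.
(* The remainder of u is, up to A, that of g, minus those of F and of eps, minus
   a term which is quadratic in s - t. *)
have -> : A (u s) - A (u t) - (s - t) *: - z =
    (g s - g t - (s - t) *: (- z - (c1 * a t ^+ 2) *: u t)) -
    (F (u s) - F (u t) - 'd F (u t) (u s - u t)) -
    (eps s - eps t - (s - t) * (- (c1 * a t ^+ 2))) *: u t -
    (eps s - eps t) *: (u s - u t).
  rewrite -AB /A /reg_deriv (gE _ Js) (gE _ Jt).
  move: (eps s) (eps t) (a t ^+ 2) ('d F (u t) (u s - u t)) => es et at2 dh.
  by apply: (ip_inj ip_inner) => h; rewrite !ipE; ring.
have q := eps_lipschitz (Jge0 Js) t0.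
have h5 : `|(eps s - eps t) *: (u s - u t)| <= c1 * (k / W) * (C * `|s - t|).
  rewrite normrZ ler_pM//; apply: le_trans q _.
  by rewrite ler_pM2l.
have h6 : `|(eps s - eps t - (s - t) * (- (c1 * a t ^+ 2))) *: u t| <=
    k / W * `|s - t| * `|u t| by rewrite normrZ ler_wpM2r.
have h7 : `|F (u s) - F (u t) - 'd F (u t) (u s - u t)| <= k / W * (C * `|s - t|).
  by apply: le_trans h1 _; rewrite ler_pM2l.
apply: le_trans (ler_normB _ _) _.
apply: le_trans (lerD (ler_normB _ _) (lexx _)) _.
apply: le_trans (lerD (lerD (ler_normB _ _) (lexx _)) (lexx _)) _.
have -> : eps t * (d * `|s - t|) = k / W * W * `|s - t|.
  by rewrite divfK ?gt_eqF// /k; ring.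
by rewrite /W; lra.
Unshelve. all: by end_near. Qed.

End OnInterval.
End NewtonFlow.

(** * Uniqueness and maximality of Newton solutions *)

Section NewtonSolutions.
Context (R : realType) (H : completeNormedModType R) (ip : {biscalar H}).
Hypothesis ip_inner : inner_product ip.
Context (B : H -> H) (f : H).
Let F := fun u : H => B u - f.
Hypothesis F_mono : monotone_op ip F.
Context (u0 : H) (c1 : R).
Hypothesis c1_gt0 : 0 < c1.

Let ipE := ipE ip.
Let a : R -> R := @harmonic5 R.
Let eps := eps_fun 5 c1 1.

Let eps_gt0 t : 0 <= t -> 0 < c1 * a t.
Proof. by move=> t0; rewrite mulr_gt0// harmonic5_gt0. Qed.

Lemma newton_solution_residual (fd : H) J u : newton_solution B f fd eps u0 J u ->
  forall t, J t -> tangent_within J (fun s => F (u s) + (c1 * a s) *: u s) t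
    (- (F (u t) + (c1 * a t) *: u t - (fd - f)) - (c1 * a t ^+ 2) *: u t).
Proof.
move=> [Ji J0 J00 u00 hu] t Jt; have [dF bij /has_derivative_withinP Tu] := hu _ Jt.
have t0 : 0 <= t by have := J0 _ Jt; rewrite /= in_itv/= andbT.
apply: (residual_of_newton ip_inner J0 Jt dF Tu); rewrite -/F.
rewrite /eps eps_fun_harmonic5// in bij *; rewrite -/a -/F in bij *.
have AN x : reg_deriv F (c1 * a t) (u t) (- x) = - reg_deriv F (c1 * a t) (u t) x.
  by rewrite /reg_deriv linearN scalerN opprD.
rewrite AN pinv_bij//; congr (- _).
by apply: (ip_inj ip_inner) => v; rewrite /F !ipE; ring.
Qed.

(** The two solutions have equal residuals, and monotonicity of F on the whole
    space recovers u from its residual, wherever the solutions go. *)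
Lemma newton_solution_unique (fd : H) J1 J2 u1 u2 :
  newton_solution B f fd eps u0 J1 u1 -> newton_solution B f fd eps u0 J2 u2 ->
  forall t, J1 t -> J2 t -> u1 t = u2 t.
Proof.
move=> N1 N2; have R1 := newton_solution_residual N1.
have R2 := newton_solution_residual N2.
have [Ji1 J01 J10 u10 _] := N1; have [Ji2 J02 J20 u20 _] := N2.
pose J := J1 `&` J2.
have Ji : is_interval J.
  move=> x y [Jx1 Jx2] [Jy1 Jy2] z xzy; split; [exact: Ji1 xzy|exact: Ji2 xzy].
have JS : J `<=` `[0, +oo[ by move=> t [/J01].
have J0 : J 0 by [].
have J_ge0 t : J t -> 0 <= t by move=> /JS; rewrite /= in_itv/= andbT.
have mono t : J t -> c1 * a t * `|u1 t - u2 t| <=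
   `|(F (u1 t) + (c1 * a t) *: u1 t) - (F (u2 t) + (c1 * a t) *: u2 t)|.
  move=> /J_ge0 t0.
  have := regularized_vi_dist ip_inner F_mono (eps_gt0 t0)
    (solution_regularized_vi ip F (c1 * a t) (K := setT) (x := u1 t) I)
    (solution_regularized_vi ip F (c1 * a t) (K := setT) (x := u2 t) I).
  by rewrite subrr normr0 mul0r addr0.
move=> t Jt1 Jt2; have Jt : J t by [].
have := residual_difference ip_inner c1_gt0 Ji JS J0
  (fun s Js => tangent_withinS (@subIsetl _ J1 J2) (R1 s Js.1))
  (fun s Js => tangent_withinS (@subIsetr _ J1 J2) (R2 s Js.2)) mono _ Jt.
rewrite u10 u20 subrr normr0 expr0n mul0r => /(_ erefl) h.
have := mono _ Jt.
have -> : `|F (u1 t) + (c1 * a t) *: u1 t - (F (u2 t) + (c1 * a t) *: u2 t)| = 0.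
  by apply/eqP; rewrite -sqrf_eq0 eq_le h sqr_ge0.
rewrite pmulr_rle0 ?eps_gt0 ?J_ge0// normr_le0 subr_eq0 => /eqP; exact.
Qed.

(** If T were missed, then J would lie in [0, T], where by uniqueness v extends u,
    against maximality. *)
Lemma maximal_newton_solution_extends (fd : H) J u v T : 0 <= T ->
  maximal_newton_solution B f fd eps u0 J u ->
  newton_solution B f fd eps u0 `[0, T] v -> J T /\ u T = v T.
Proof.
move=> T0 [Nu Jmax] Nv.
have IT : `[0, T]%classic T by rewrite /= in_itv/= T0 lexx.
suff JT : J T by split=> //; exact: newton_solution_unique Nu Nv _ JT IT.
have [//|nJT] := pselect (J T).
have [Ji J0 J00 _ _] := Nu.
have JS : J `<=` `[0, T].
  move=> t Jt; have := J0 _ Jt; rewrite /= !in_itv/= andbT => t0; rewrite t0/=.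
  rewrite leNgt; apply/negP => tT; apply: nJT; apply: (Ji _ _ J00 Jt).
  by rewrite T0 ltW.
rewrite -(Jmax _ _ Nv JS) // => t Jt.
by apply: (newton_solution_unique Nv Nu) => //; exact: JS.
Qed.

Lemma newton_solution_of_flow (rho : R) (fd : H) J (g u : R -> H) :
  0 <= rho ->
  (forall v, cball u0 rho v -> differentiable F v) ->
  is_interval J -> J `<=` `[0, +oo[ -> J 0 -> u 0 = u0 ->
  (forall t, J t -> regularized_vi ip F (cball u0 rho) (c1 * a t) (g t) (u t)) ->
  (forall t, J t -> `|u t - u0| < rho) ->
  (forall t, J t -> tangent_within J g t
     (- (g t - (fd - f)) - (c1 * a t ^+ 2) *: u t)) ->
  newton_solution B f fd eps u0 J u.
Proof.
move=> rho0 dF Ji JS J0 u00 hvi hin Tg; split=> // t Jt.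
have t0 : 0 <= t by have := JS _ Jt; rewrite /= in_itv/= andbT.
have dFt : differentiable F (u t) by apply: dF; exact: ltW (hin _ Jt).
rewrite /eps eps_fun_harmonic5//; split => //.
  exact: (reg_deriv_bijective ip_inner F_mono dFt (eps_gt0 t0)).
apply/has_derivative_withinP.
have := newton_of_residual ip_inner F_mono rho0 c1_gt0 dF JS hvi hin Jt (Tg _ Jt).
have <- := regularized_vi_interior ip_inner (hvi _ Jt) (hin _ Jt).
have -> // : F (u t) + (c1 * a t) *: u t - (fd - f) = B (u t) - fd + (c1 * a t) *: u t.
by apply: (ip_inj ip_inner) => v; rewrite /F !ipE; ring.
Qed.

End NewtonSolutions.

(** * Convergence of the exact flow *)

Section RegularizedFlow.
Context (R : realType) (H : completeNormedModType R) (ip : {biscalar H}).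
Hypothesis ip_inner : inner_product ip.
Context (F : H -> H) (y u0 : H) (M : R).
Hypothesis F_mono : monotone_op ip F.
Hypotheses (Fy : F y = 0) (y_min : forall z, F z = 0 -> `|y| <= `|z|).

Let r := `|y| + `|u0|.
Let K := cball u0 (3 * r).
Hypothesis r_gt0 : 0 < r.
Hypothesis F_diff : forall u, K u -> differentiable F u.
Hypothesis F_bound : forall u, K u -> forall h, `|'d F u h| <= M * `|h|.

Let c1 : R := 10 * `|F u0| / r + 1.
Let a : R -> R := @harmonic5 R.
Let rho_ge0 : 0 <= 3 * r. Proof. by rewrite mulr_ge0// ltW. Qed.

Let c1_gt0 : 0 < c1.
Proof. by rewrite ltr_wpDl// divr_ge0 ?mulr_ge0// ltW. Qed.

Let eps_gt0 t : 0 <= t -> 0 < c1 * a t.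
Proof. by move=> t0; rewrite mulr_gt0// harmonic5_gt0. Qed.

Let Ku0 : K u0. Proof. by rewrite /K /cball /= subrr normr0. Qed.

Let Ky : K y.
Proof.
by rewrite /K /cball /=; apply: le_trans (ler_normB _ _) _;
  rewrite ler_peMl ?ler1n// ltW.
Qed.

Let g0 := F u0 + (c1 * a 0) *: u0.

Lemma flow_initial_value (g u : R -> H) : g 0 = g0 ->
  regularized_vi ip F K (c1 * a 0) (g 0) (u 0) -> u 0 = u0.
Proof.
move=> -> h.
have := regularized_vi_dist ip_inner F_mono (eps_gt0 (lexx 0)) h
  (solution_regularized_vi ip F (c1 * a 0) Ku0).
rewrite !subrr !normr0 mul0r addr0 pmulr_rle0 ?eps_gt0// normr_le0 subr_eq0.
by move=> /eqP.
Qed.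

(** What the size of c1 is for: |g0| / eps(0) <= |F u0| / eps(0) + |u0|, and
    eps(0) = c1 / 5 is large enough for the first term to be at most r / 2. *)
Lemma initial_residual_bound : `|g0| ^+ 2 <= (c1 * a 0) ^+ 2 * (45 / 4 * r ^+ 2 * a 0).
Proof.
have a05 : a 0 = 1 / 5 by rewrite /a /harmonic5 addr0 div1r.
have h1 : `|F u0| <= c1 * (r / 10).
  have -> : c1 * (r / 10) = `|F u0| + r / 10.
    by rewrite /c1; field; rewrite gt_eqF.
  by rewrite lerDl divr_ge0// ltW.
have h2 : `|g0| <= c1 * (1 / 5) * (3 / 2 * r).
  apply: le_trans (ler_normD _ _) _; rewrite normrZ a05 ger0_norm; last first.
    by rewrite mulr_ge0// ltW.
  have : c1 * `|u0| <= c1 * r by rewrite ler_pM2l// /r lerDr.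
  by move: h1; lra.
have := normr_ge0 g0; rewrite a05 => h3.
have -> : (c1 * (1 / 5)) ^+ 2 * (45 / 4 * r ^+ 2 * (1 / 5)) =
  (c1 * (1 / 5) * (3 / 2 * r)) ^+ 2 by field.
by rewrite ler_sqr ?nnegrE//; apply: le_trans h2.
Qed.

(** The regularized solutions w t stay in the ball of radius |y| and tend to y,
    while u - w is controlled by the decay of the residual. *)
Lemma regularized_flow : exists g u : R -> H,
  [/\ g 0 = g0 /\ u 0 = u0,
      forall t, 0 <= t -> regularized_vi ip F K (c1 * a t) (g t) (u t) /\
        tangent_within `[0, +oo[ g t (- (g t - 0) - (c1 * a t ^+ 2) *: u t),
      forall t, 0 <= t -> `|u t - u0| <= 5 / 2 * r &
      u t @[t --> +oo] --> y].
Proof.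
have [g [u [g00 hgu]]] :=
  residual_flow ip_inner F_mono rho_ge0 c1_gt0 F_diff F_bound 0 g0.
have hex (t : R) : exists x : H, 0 <= t -> regularized_vi ip F K (c1 * a t) 0 x.
  have [t0|t0] := boolP (0 <= t); last by exists 0.
  have [x hx] := regularized_vi_exists ip_inner F_mono 0 rho_ge0 (eps_gt0 t0)
    (cball_lipschitz ip_inner F_diff F_bound).
  by exists x.
have [w hw] := choice hex.
have wy t : 0 <= t -> `|w t| <= `|y|.
  move=> t0; rewrite -ler_sqr ?nnegrE// -subr_ge0.
  have := regularized_vi_zero ip_inner F_mono (eps_gt0 t0) (hw _ t0) Ky Fy.
  by apply: le_trans; exact: sqr_ge0.
have uw t : 0 <= t -> c1 * a t * `|u t - w t| <= `|g t|.
  move=> t0.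
  have := regularized_vi_dist ip_inner F_mono (eps_gt0 t0) (hgu _ t0).1 (hw _ t0).
  by rewrite subr0 subrr normr0 mul0r addr0.
(* With this C the bound C / (5 + t) is (3 r / 2)^2 at time 0, and it exceeds
   (5 / 4) |y|^2. *)
pose C := 45 / 4 * r ^+ 2.
have gC t : 0 <= t -> `|g t| ^+ 2 <= (c1 * a t) ^+ 2 * (C * a t).
  move=> t0; pose J : set R := [set` `[0, +oo[].
  have Jge0 s : J s -> 0 <= s by rewrite /J /= in_itv/= andbT.
  have Jin s : 0 <= s -> J s by rewrite /J /= in_itv/= andbT.
  apply: (@residual_decay _ _ _ ip_inner _ c1_gt0 J
    (@interval_is_interval R _) _ _ g u `|y| C) => //.
  - exact: Jin.
  - have : `|y| ^+ 2 <= r ^+ 2 by rewrite ler_sqr ?nnegrE ?(ltW r_gt0)// lerDl.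
    by have := sqr_ge0 `|y|; rewrite /C; lra.
  - by move=> s /Jge0 /hgu[_]; rewrite subr0.
  - move=> s /Jge0 s0; apply: le_trans (_ : c1 * a s * (`|w s| + `|u s - w s|) <= _).
      rewrite ler_pM2l ?eps_gt0// -{1}[u s](subrKC (w s)); exact: ler_normD.
    rewrite mulrDr lerD ?uw// ler_pM2l ?eps_gt0//; exact: wy.
  - by rewrite g00; exact: initial_residual_bound.
  - exact: Jin.
have uwC t : 0 <= t -> `|u t - w t| ^+ 2 <= C * a t.
  move=> t0; have e2 : 0 < (c1 * a t) ^+ 2 by rewrite exprn_gt0// eps_gt0.
  rewrite -(ler_pM2l e2); apply: le_trans (gC _ t0).
  rewrite -exprMn ler_sqr ?nnegrE ?uw// mulr_ge0// ltW// eps_gt0//.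
have C0 : 0 <= C by rewrite mulr_ge0 ?sqr_ge0.
exists g, u; split=> //.
- split=> //; apply: (flow_initial_value g00); exact: (hgu 0 (lexx 0)).1.
- move=> t t0; have h : `|u t - w t| <= 3 / 2 * r.
    rewrite -ler_sqr ?nnegrE// ?mulr_ge0 ?(ltW r_gt0)//.
    apply: le_trans (uwC _ t0) _.
    apply: (@le_trans _ _ (C * (1 / 5))); first by rewrite ler_wpM2l// harmonic5_le.
    by rewrite /C; lra.
  rewrite -(subrKA (w t)); apply: le_trans (ler_normD _ _) _.
  have := ler_normB (w t) u0; have := wy _ t0; rewrite /r in h *; lra.
- have cw : w t @[t --> +oo] --> y.
    apply: (regularized_vi_cvg ip_inner F_mono (cball_closed (rho := _)) Ky Fy
      y_min (e := fun t => c1 * a t)) => //.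
    + by move=> x /F_diff; exact: differentiable_continuous.
    + by move=> s t s0 st; rewrite ler_pM2l//; exact: harmonic5_anti.
    + by rewrite -[X in _ --> X](mulr0 c1); exact: (cvgM (cvg_cst c1) (@harmonic5_cvg0 R)).
    + exists 0 => // t t0; apply: (regularized_vi_interior ip_inner (hw _ t0)).
      apply: le_lt_trans (ler_normB _ _) _; apply: (@le_lt_trans _ _ r).
        by rewrite lerD2r wy.
      by move: r_gt0; lra.
  have cuw : u t - w t @[t --> +oo] --> (0 : H).
    apply/cvgrPdist_le => e e0.
    have C1 : 0 < C + 1 by rewrite ltr_wpDl.
    have ca : \forall t \near +oo, a t <= e ^+ 2 / (C + 1).
      have /cvgrPdist_le h := @harmonic5_cvg0 R.
      have := h (e ^+ 2 / (C + 1)); rewrite divr_gt0 ?exprn_gt0// => /(_ isT).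
      by apply: filterS => t; rewrite sub0r normrN; apply: le_trans; rewrite ler_norm.
    near=> t; have t0 : 0 <= t by near: t; exact: nbhs_pinfty_ge.
    have : a t <= e ^+ 2 / (C + 1) by near: t.
    rewrite ler_pdivlMr// => h; rewrite sub0r normrN.
    rewrite -ler_sqr ?nnegrE ?(ltW e0)//; apply: le_trans (uwC _ t0) (le_trans _ h).
    by rewrite mulrC ler_wpM2l ?lerDl//; apply: ltW; exact: harmonic5_gt0.
  have -> : u = (fun t => (u t - w t) + w t) by apply/funext => t; rewrite subrK.
  by rewrite -(add0r y); exact: cvgD cuw cw.
Unshelve. all: by end_near. Qed.

End RegularizedFlow.

(** * Noisy data *)

(** Picks the stopping time: comparing with the value at any fixed time then
    suffices for the limit. *)
Lemma near_minimizer (R : realType) (S : set R) (phi : R -> R) (d : R) :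
  S !=set0 -> (forall s, 0 <= phi s) -> 0 < d ->
  exists2 t, S t & forall s, S s -> phi t <= phi s + d.
Proof.
move=> S0 phi0 d0; have hinf : has_inf (phi @` S).
  by split; [exact: image_nonempty|exists 0 => _ [s _ <-]].
have [_ [t St <-] ht] := inf_adherent d0 hinf.
exists t => // s Ss; apply: le_trans (ltW ht) _; rewrite lerD2r.
by apply: ge_inf; [exact: hinf.2|exists s].
Qed.

Section Perturbation.
Context (R : realType) (H : completeNormedModType R) (ip : {biscalar H}).
Hypothesis ip_inner : inner_product ip.
Context (B : H -> H) (f y u0 : H) (M : R).
Let F := fun u : H => B u - f.
Hypothesis F_mono : monotone_op ip F.
Hypotheses (Fy : F y = 0) (y_min : forall z, F z = 0 -> `|y| <= `|z|).
Let r := `|y| + `|u0|.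
Let K := cball u0 (3 * r).
Hypothesis r_gt0 : 0 < r.
Hypothesis F_diff : forall u, K u -> differentiable F u.
Hypothesis F_bound : forall u, K u -> forall h, `|'d F u h| <= M * `|h|.
Let c1 : R := 10 * `|F u0| / r + 1.
Let a : R -> R := @harmonic5 R.
Let eps := eps_fun 5 c1 1.

Let rho_ge0 : 0 <= 3 * r. Proof. by rewrite mulr_ge0// ltW. Qed.
Let c1_gt0 : 0 < c1.
Proof. by rewrite ltr_wpDl// divr_ge0 ?mulr_ge0// ltW. Qed.

(** On a fixed [0, T] the noisy flow is as close as desired to the exact one; as
    the latter keeps the distance r / 2 to the sphere, the former stays inside the
    ball, hence solves the Newton equation. *)
Lemma perturbed_solution (g u : R -> H) (T e : R) : 0 <= T -> 0 < e ->
  g 0 = F u0 + (c1 * a 0) *: u0 ->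
  (forall t, 0 <= t -> regularized_vi ip F K (c1 * a t) (g t) (u t) /\
     tangent_within `[0, +oo[ g t (- (g t - 0) - (c1 * a t ^+ 2) *: u t)) ->
  (forall t, 0 <= t -> `|u t - u0| <= 5 / 2 * r) ->
  exists2 d, 0 < d & forall fd, `|fd - f| <= d -> exists v : R -> H,
    newton_solution B f fd eps u0 `[0, T] v /\ `|v T - u T| <= e.
Proof.
move=> T0 e0 g00 hgu u_in.
(* The exact flow stays within 5 r / 2 of u0, so r / 4 leaves it inside 3 r. *)
pose m := Num.min e (r / 4); have m0 : 0 < m by rewrite lt_min e0 divr_gt0.
exists (c1 * a T * m / (1 + T)).
  by rewrite divr_gt0 ?ltr_wpDr// !mulr_gt0// harmonic5_gt0.
move=> fd hfd.
have [g' [v [g'0 hgv]]] :=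
  residual_flow ip_inner F_mono rho_ge0 c1_gt0 F_diff F_bound (fd - f) (g 0).
pose J : set R := [set` `[0, +oo[].
have Jge0 s : J s -> 0 <= s by rewrite /J /= in_itv/= andbT.
have Jin s : 0 <= s -> J s by rewrite /J /= in_itv/= andbT.
have eps_gt0 t : 0 <= t -> 0 < c1 * a t by move=> t0; rewrite mulr_gt0// harmonic5_gt0.
have vu t : 0 <= t -> c1 * a t * `|v t - u t| <= `|g' t - g t|.
  move=> t0.
  have := regularized_vi_dist ip_inner F_mono (eps_gt0 _ t0) (hgv _ t0).1 (hgu _ t0).1.
  by rewrite subrr normr0 mul0r addr0.
have close t : 0 <= t -> t <= T -> `|v t - u t| <= m.
  move=> t0 tT.
  have h := @residual_difference _ _ _ ip_inner _ c1_gt0 J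
    (@interval_is_interval R _) (fun _ x => x) (Jin 0 (lexx 0)) g' g v u (fd - f) 0
    (fun s Js => (hgv _ (Jge0 _ Js)).2) (fun s Js => (hgu _ (Jge0 _ Js)).2)
    (fun s Js => vu _ (Jge0 _ Js)) g'0 _ (Jin _ t0).
  have T1 : 0 < 1 + T by rewrite ltr_wpDr.
  have gg : `|g' t - g t| <= `|fd - f| * (1 + T).
    rewrite -ler_sqr ?nnegrE ?mulr_ge0 ?(ltW T1)//; apply: le_trans h _.
    rewrite subr0 exprMn ler_wpM2l ?sqr_ge0//; nra.
  have eT := eps_gt0 _ T0.
  rewrite -(ler_pM2l eT).
  apply: (@le_trans _ _ (c1 * a t * `|v t - u t|)).
    by rewrite ler_wpM2r// ler_pM2l//; exact: harmonic5_anti.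
  apply: le_trans (vu _ t0) (le_trans gg _).
  by rewrite -ler_pdivlMr.
exists v; split; last first.
  by apply: le_trans (close _ T0 (lexx T)) _; rewrite ge_min lexx.
pose JT : set R := [set` `[0, T]].
have JTP s : JT s -> 0 <= s /\ s <= T by rewrite /JT /= in_itv/= => /andP[].
have JS : JT `<=` J by move=> s /JTP[/Jin].
apply: (@newton_solution_of_flow _ _ _ ip_inner B f F_mono u0 c1 c1_gt0 (3 * r) fd JT g' v)
  => //.
- exact: interval_is_interval.
- by rewrite /JT /= in_itv/= lexx.
- have := flow_initial_value ip_inner F_mono r_gt0 (g := g') (u := v).
  by apply; [rewrite g'0 g00 | exact: (hgv _ (lexx 0)).1].
- by move=> t /JTP[t0 _]; exact: (hgv _ t0).1.
- move=> t /JTP[t0 tT]; rewrite -(subrKA (u t)).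
  apply: le_lt_trans (ler_normD _ _) _.
  have := u_in _ t0; have := close _ t0 tT.
  have : m <= r / 4 by rewrite /m ge_min lexx orbT.
  by move: r_gt0; lra.
- by move=> t /[dup] /JTP[t0 _] JTt; apply: tangent_withinS JS _; exact: (hgv _ t0).2.
Qed.

End Perturbation.

Theorem theorem4p2 (R : realType) (H : completeNormedModType R)
    (ip : {biscalar H}) (ip_inner : inner_product ip)
    (B F : H -> H) (f : H) (F_def : F = (fun u : H => B u - f))
    (F_mono : monotone_op ip F)
    (y : H) (y_zero : F y = 0)
    (y_min : forall z : H, F z = 0 -> `|y| <= `|z|)
    (u0 : H) (r rho : R) (r_def : r = `|y| + `|u0|) (rho_def : rho = 3 * r)
    (F2 : H -> {bilinear H -> H -> H})
    (F_diff : second_derivative_on F F2 (cball u0 rho))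
    (M1 M2 : R)
    (F1_bound :
       (ereal_sup [set opnorm ('d F u : H -> H) | u in cball u0 rho]
          <= M1%:E)%E)
    (F2_bound :
       (ereal_sup [set opnorm2 (F2 u) | u in cball u0 rho] <= M2%:E)%E) :
  exists c0 c1 b : R,
    [/\ 0 < c0, 0 < c1, 0 < b,
        (exists u : R -> H,
           [/\ newton_solution B f f (eps_fun c0 c1 b) u0 `[0, +oo[ u,
               forall t : R, 0 <= t -> cball u0 rho (u t) &
               exists uoo : H, u t @[t --> +oo] --> uoo /\ F uoo = 0]) &
        forall (f_ : R -> H) (J_ : R -> set R) (u_ : R -> R -> H),
          (forall d : R, 0 < d -> `|f_ d - f| <= d) ->
          (forall d : R, 0 < d ->
             maximal_newton_solution B f (f_ d) (eps_fun c0 c1 b) u0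
               (J_ d) (u_ d)) ->
          exists t_ : R -> R,
            (forall d : R, 0 < d -> J_ d (t_ d)) /\
            `|u_ d (t_ d) - y| @[d --> 0^'+] --> 0].
Proof.
have {F2_bound M2 F_diff F2} dF u : cball u0 rho u -> differentiable F u.
  by move=> /F_diff[].
have {F1_bound} bF u : cball u0 rho u -> forall h, `|'d F u h| <= M1 * `|h|.
  move=> Ku; apply: opnorm_le; apply: le_trans F1_bound.
  by apply: ereal_sup_ubound; exists u.
subst F r rho.
have [r0|r0] := eqVneq (`|y| + `|u0|) 0.
  (* The ball is a single point: u0 is a zero of F, the constant curve is a
     solution, and time 0 is a valid choice of t_delta. *)
  have [y0 u00] : y = 0 /\ u0 = 0.
    by move/eqP: r0; rewrite paddr_eq0// !normr_eq0 => /andP[/eqP-> /eqP->].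
  subst y u0; have K0 : cball 0 (3 * (`|0 : H| + `|0 : H|)) (0 : H).
    by rewrite /cball /= subrr normr0 addr0 mulr0.
  exists 1, 1, 1; split=> //.
    exists (fun=> 0); split=> //; last by exists 0; split=> //; exact: cvg_cst.
    split=> //; [exact: interval_is_interval|by rewrite /= in_itv/= lexx|].
    move=> t; rewrite /= in_itv/= andbT => t0.
    have e_gt0 : 0 < eps_fun 1 1 1 t.
      by rewrite /eps_fun mul1r powR_gt0// ltr_wpDr.
    have bij := reg_deriv_bijective ip_inner F_mono (dF _ K0) e_gt0.
    split=> //; first exact: dF.
    apply/has_derivative_withinP; rewrite scaler0 addr0 y_zero.
    have -> : pinv setT (reg_deriv (fun u : H => B u - f) (eps_fun 1 1 1 t) 0) 0 = 0.
      apply: (bij_inj bij); rewrite pinv_bij//.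
      by rewrite /reg_deriv linear0 scaler0 addr0.
    by rewrite oppr0; exact: tangent_within_cst.
  move=> f_ J_ u_ _ hmax; exists (fun=> 0); split.
    by move=> d /hmax[[]].
  apply: cvg_near_cst; near=> d.
  have d0 : 0 < d by near: d; exact: nbhs_right_gt.
  by have [[_ _ _ -> _] _] := hmax _ d0; rewrite subrr normr0.
have r_gt0 : 0 < `|y| + `|u0| by rewrite lt_def r0 addr_ge0.
have [g [u [[g00 u00] hgu u_in u_cvg]]] :=
  regularized_flow ip_inner F_mono y_zero y_min r_gt0 dF bF.
set c1 := (10 * _ / _ + 1) in g00 hgu.
have c1_gt0 : 0 < c1 by rewrite ltr_wpDl// divr_ge0 ?mulr_ge0// ltW.
exists 5, c1, 1; split=> //.
- exists u; split.
  + pose J : set R := [set` `[0, +oo[].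
    have Jge0 s : J s -> 0 <= s by rewrite /J /= in_itv/= andbT.
    apply: (@newton_solution_of_flow _ _ _ ip_inner B f F_mono u0 c1 c1_gt0
      (3 * (`|y| + `|u0|)) f J g u) => //.
    * exact: interval_is_interval.
    * by rewrite /J /= in_itv/= lexx.
    * by move=> t /Jge0/hgu[].
    * by move=> t /Jge0/u_in ut; apply: le_lt_trans ut _; lra.
    * by move=> t /Jge0/hgu[_]; rewrite (subrr f).
  + by move=> t /u_in ut; apply: le_trans ut _; lra.
  + by exists y.
- move=> f_ J_ u_ hf hmax.
  have hex (d : R) : exists t : R, 0 < d -> J_ d t /\
      forall s, J_ d s -> `|u_ d t - y| <= `|u_ d s - y| + d.
    have [d0|d0] := boolP (0 < d); last by exists 0.
    have [t Jt ht] := @near_minimizer R (J_ d) (fun s => `|u_ d s - y|) d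
      (ex_intro _ 0 (let: And5 _ _ J0 _ _ := (hmax _ d0).1 in J0))
      (fun s => normr_ge0 _) d0.
    by exists t.
  have [t_ ht] := choice hex.
  exists t_; split; first by move=> d /ht[].
  apply/cvgrPdist_le => e e0.
  have e3 : 0 < e / 3 by rewrite divr_gt0.
  have [T [T0 uT]] : exists T, 0 <= T /\ `|u T - y| <= e / 3.
    have /cvgrPdist_le/(_ _ e3) hT := u_cvg.
    near +oo_R => T; exists T; split; first by near: T; exact: nbhs_pinfty_ge.
    by rewrite distrC; near: T.
  have [d1 d10 hd1] := perturbed_solution ip_inner F_mono r_gt0 dF bF
    T0 e3 g00 hgu u_in.
  near=> d.
  have d0 : 0 < d by near: d; exact: nbhs_right_gt.
  have dd1 : d <= d1 by near: d; exact: nbhs_right_le.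
  have de : d <= e / 3 by near: d; exact: nbhs_right_le.
  have [v [Nv vT]] := hd1 _ (le_trans (hf _ d0) dd1).
  have [JT uvT] := maximal_newton_solution_extends ip_inner F_mono c1_gt0 T0 (hmax _ d0) Nv.
  rewrite sub0r normrN normr_id.
  apply: le_trans ((ht _ d0).2 _ JT) _; rewrite uvT.
  have := ler_normD (v T - u T) (u T - y); rewrite subrKA; lra.
Unshelve. all: by end_near. Qed.
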